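(* If $\Gamma$ is a circular polygon, then there are constants $c_-<c_+<0$ such that for any fixed $c\in[c_-,c_+]$ there exists a sequence $(g_q)_q$ (indexed by all sufficiently large $q$), with $g_q\in\Pi(1,q)$, such that $$L(g_q)=|\Gamma|+c/q^2+\mathrm{O}(1/q^3),\qquad\text{as } q\to+\infty.$$ Consequently, there exists a sequence $(h_q)_q$, with $h_q\in\Pi(1,q)$, such that $$c_-=\liminf_{q\to+\infty}\big((L(h_q)-|\Gamma|)q^2\big)<\limsup_{q\to+\infty}\big((L(h_q)-|\Gamma|)q^2\big)=c_+ .$$ Besides, $c_-\le-\pi^2|\Gamma|/6$ and $c_+=-\frac1{24}\left[\int_\Gamma\kappa^{2/3}(s)\,ds\right]^3$, where $\kappa(s)$ is the curvature of $\Gamma$ as a function of an arc-length parameter $s\in[0,|\Gamma|)$.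
   Context: **Circular polygons.** A circular $k$-gon is a simple closed strictly convex curve $\Gamma\subset\mathbb{R}^2\simeq\mathbb{C}$ formed by the concatenation of $k>1$ circular arcs $\Gamma_1,\dots,\Gamma_k$ (listed counter-clockwise, index modulo $k$) that is $C^1$ but not $C^2$ at the intersection point (node) of any two consecutive arcs; so consecutive arcs have different radii, and circles are excluded. A circular polygon is a circular $k$-gon for some $k$. $|\Gamma|$ is the length of $\Gamma$; its curvature is piecewise constant. The arc $\Gamma_j$ has center $O_j$, radius $r_j>0$ and angular range $[a_j,b_j]$, with $b_j=a_{j+1}$ and $a_1<b_1=a_2<\cdots<b_k=a_1+2\pi$. The polar parametrisation is $z:\mathbb{T}=\mathbb{R}/2\pi\mathbb{Z}\to\Gamma$, $z(\varphi)=O_j+r_je^{i\varphi}$ for $\varphi\in[a_j,b_j]$. **Billiard map.** For $0<\theta<\pi$, the line through $z(\varphi)$ in the direction $v$ obtained by rotating $z'(\varphi)$ counter-clockwise by $\theta$ meets $\Gamma$ at exactly one other point $z(\bar\varphi)$; $\bar\theta\in(0,\pi)$ is the counter-clockwise angle from $v$ to $z'(\bar\varphi)$, and $f(\varphi,\theta)=(\bar\varphi,\bar\theta)$. **Periodic trajectories.** $\Pi(1,q)$, $q\ge2$, is the set of periodic billiard trajectories in $\Gamma$ that close after one turn around $\Gamma$ and $q$ impacts: $f^q(x)=x$ and, lifting the impact angles to $\mathbb{R}$ so that $\varphi_{n+1}\in(\varphi_n,\varphi_n+2\pi)$, one has $\varphi_q=\varphi_0+2\pi$. If $g=\{z_0,\dots,z_{q-1}\}\subset\Gamma$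 are the consecutive impact points of a $q$-periodic trajectory, its length is $L(g)=|z_1-z_0|+\cdots+|z_{q-1}-z_{q-2}|+|z_0-z_{q-1}|$. *)

(* Defs.v *)
(* Stdlib reals with Coquelicot; the plane R^2 is Coquelicot's type C. *)
From Stdlib Require Import Reals Lra Lia.
From Coquelicot Require Import Coquelicot.
Open Scope R_scope.

(* The unit vector e^{i phi}. *)
Definition cis (phi : R) : C := (cos phi, sin phi).

(* Arcs are numbered 0, ..., nb_arcs - 1 counter-clockwise, and arc j has
   angular range [angle j, angle (j + 1)]; values of the three functions at
   larger indices are irrelevant. *)
Record arcs := Arcs {
  nb_arcs : nat;
  center : nat -> C;
  radius : nat -> R;
  angle : nat -> R
}.

(* For t 0 < t 1 < ... < t (n + 1), cell t n x is the index j <= n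
   with t j <= x < t (j + 1), whenever t 0 <= x < t (n + 1). *)
Fixpoint cell (t : nat -> R) (n : nat) (x : R) : nat :=
  match n with
  | O => O
  | S m => if Rle_dec (t (S m)) x then S m else cell t m x
  end.

(* The representative of phi modulo 2 PI in [base, base + 2 PI[;
   Int_part is the floor function. *)
Definition reduce_angle (base phi : R) : R :=
  phi - 2 * PI * IZR (Int_part ((phi - base) / (2 * PI))).

(* The polar parametrisation z, as a 2 PI-periodic function on R; see the
   lemmas z_arc and z_periodic below. *)
Definition z (G : arcs) (phi : R) : C :=
  let phi0 := reduce_angle (angle G 0) phi in
  let j := cell (angle G) (nb_arcs G - 1) phi0 in
  Cplus (center G j) (Cmult (RtoC (radius G j)) (cis phi0)).

Definition on_curve (G : arcs) (P : C) : Prop := exists phi : R, P = z G phi.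

(* At the point of angle b on a circle of radius r > 0 the tangent vector is
   r i e^{ib}.  Hence the concatenation is C^1 at a node as soon as its two
   arcs meet there at the same angle b, and it is then C^2 there iff the two
   radii agree. *)
Record circular_polygon (G : arcs) : Prop := {
  cp_nb_arcs : (1 < nb_arcs G)%nat;
  cp_radius : forall j : nat, (j < nb_arcs G)%nat -> 0 < radius G j;
  cp_angle : forall j : nat, (j < nb_arcs G)%nat -> angle G j < angle G (S j);
  cp_turn : angle G (nb_arcs G) = angle G 0 + 2 * PI;
  cp_node : forall j : nat, (j < nb_arcs G)%nat ->
    let j' := (S j mod nb_arcs G)%nat in
    Cplus (center G j) (Cmult (RtoC (radius G j)) (cis (angle G (S j)))) =
    Cplus (center G j') (Cmult (RtoC (radius G j')) (cis (angle G (S j))));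
  cp_not_C2 : forall j : nat, (j < nb_arcs G)%nat ->
    radius G j <> radius G (S j mod nb_arcs G);
  cp_simple : forall phi psi : R,
    phi < psi < phi + 2 * PI -> z G phi <> z G psi;
  (* no line meets the curve in three distinct points *)
  cp_strictly_convex : forall P Q S : C,
    on_curve G P -> on_curve G Q -> on_curve G S ->
    P <> Q -> Q <> S -> P <> S ->
    ~ (exists t : R, S = Cplus P (Cmult (RtoC t) (Cminus Q P)))
}.

(* |z'(phi)|; the value at a node, where z may fail to be differentiable, is
   irrelevant since speed is only used under an integral. *)
Definition speed (G : arcs) (phi : R) : R :=
  Cmod (Derive (fun t => fst (z G t)) phi, Derive (fun t => snd (z G t)) phi).

Definition arclength (G : arcs) (phi : R) : R :=
  RInt (speed G) (angle G 0) phi.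

Definition perimeter (G : arcs) : R := arclength G (angle G 0 + 2 * PI).

(* The curvature as a function of the arc-length parameter s in
   [0, perimeter G[, counted from the first node: it is 1 / radius G j on the
   part of the curve covered by arc j; see the lemma curvature_arc below. *)
Definition curvature (G : arcs) (s : R) : R :=
  / radius G (cell (fun j => arclength G (angle G j)) (nb_arcs G - 1) s).

(* The direction of z'(phi), also at the nodes. *)
Definition tangent (phi : R) : C := Cmult Ci (cis phi).

(* The graph of the billiard map f, (phi', theta') = f (phi, theta), with
   angles phi, phi' taken modulo 2 PI.  Multiplication by e^{i theta} is the
   counter-clockwise rotation by theta. *)
Definition billiard_map (G : arcs) (x x' : R * R) : Prop :=
  let (phi, theta) := x in
  let (phi', theta') := x' in
  let v := Cmult (cis theta) (tangent phi) in
  0 < theta < PI /\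
  z G phi' <> z G phi /\
  (exists t : R, z G phi' = Cplus (z G phi) (Cmult (RtoC t) v)) /\
  0 < theta' < PI /\
  Cmult (cis theta') v = tangent phi'.

(* The set Pi(1, q): g n = (phi_n, theta_n) for 0 <= n <= q, the impact angles
   being lifted to R. *)
Definition one_turn_periodic (G : arcs) (q : nat) (g : nat -> R * R) : Prop :=
  (2 <= q)%nat /\
  (forall n : nat, (n < q)%nat ->
     billiard_map G (g n) (g (S n)) /\
     fst (g n) < fst (g (S n)) < fst (g n) + 2 * PI) /\
  fst (g q) = fst (g 0%nat) + 2 * PI /\
  snd (g q) = snd (g 0%nat).

Definition traj_length (G : arcs) (q : nat) (g : nat -> R * R) : R :=
  sum_n (fun n : nat =>
    Cmod (Cminus (z G (fst (g (S n mod q)%nat))) (z G (fst (g n))))) (q - 1).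

(* u_q = O(1 / q^m) as q -> +oo. *)
Definition bigO_inv_pow (m : nat) (u : nat -> R) : Prop :=
  exists M : R, eventually (fun q : nat => Rabs (u q) <= M / INR q ^ m).

Lemma cell_eq (t : nat -> R) (n j : nat) (x : R) :
  (forall i, (i < n)%nat -> t i <= t (S i)) -> (j <= n)%nat ->
  t j <= x -> ((j < n)%nat -> x < t (S j)) -> cell t n x = j.
Proof.
intros Ht; induction n as [|n IH]; intros Hj Hl Hr; simpl.
- lia.
- assert (Hmono : forall i l, (i + l <= S n)%nat -> t i <= t (i + l)%nat).
  { intros i l; induction l as [|l IHl]; intros H.
    - rewrite Nat.add_0_r; lra.
    - rewrite Nat.add_succ_r; apply Rle_trans with (t (i + l)%nat).
      + apply IHl; lia.
      + apply Ht; lia. }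
  destruct (Rle_dec (t (S n)) x) as [H|H].
  + destruct (Nat.eq_dec j (S n)) as [e|e]; [easy|].
    assert (Hx : x < t (S j)) by (apply Hr; lia).
    assert (Hm := Hmono (S j) (n - j)%nat).
    replace (S j + (n - j))%nat with (S n) in Hm by lia.
    specialize (Hm (Nat.le_refl _)); lra.
  + apply IH; [intros i Hi; apply Ht; lia| | easy |intros Hi; apply Hr; lia].
    destruct (Nat.eq_dec j (S n)) as [e|e]; [subst; contradiction|lia].
Qed.

Lemma cis_periodic (phi : R) : cis (phi + 2 * PI) = cis phi.
Proof. unfold cis; rewrite cos_plus, sin_plus, cos_2PI, sin_2PI; f_equal; ring. Qed.

Lemma reduce_angle_id (b phi : R) :
  b <= phi < b + 2 * PI -> reduce_angle b phi = phi.
Proof.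
intros H; unfold reduce_angle; pose proof PI_RGT_0 as Hpi.
assert (Hlo : 0 <= (phi - b) / (2 * PI)).
{ apply Rdiv_le_0_compat; lra. }
assert (Hhi : (phi - b) / (2 * PI) < 1).
{ apply Rlt_div_l; lra. }
destruct (base_Int_part ((phi - b) / (2 * PI))) as [H1 H2].
assert (H3 : IZR (Int_part ((phi - b) / (2 * PI))) < 1) by lra.
assert (H4 : -1 < IZR (Int_part ((phi - b) / (2 * PI)))) by lra.
apply lt_IZR in H3; apply lt_IZR in H4.
replace (Int_part ((phi - b) / (2 * PI))) with 0%Z by lia; lra.
Qed.

Lemma reduce_angle_periodic (b phi : R) :
  reduce_angle b (phi + 2 * PI) = reduce_angle b phi.
Proof.
unfold reduce_angle; pose proof PI_RGT_0 as Hpi.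
replace ((phi + 2 * PI - b) / (2 * PI)) with ((phi - b) / (2 * PI) + 1)
  by (field; lra).
set (y := (phi - b) / (2 * PI)).
destruct (base_Int_part y) as [H1 H2].
destruct (base_Int_part (y + 1)) as [H3 H4].
assert (H5 : IZR (Int_part (y + 1)) < IZR (Int_part y + 2)) by (rewrite plus_IZR; lra).
assert (H6 : IZR (Int_part y) < IZR (Int_part (y + 1))) by lra.
apply lt_IZR in H5; apply lt_IZR in H6.
replace (Int_part (y + 1)) with (Int_part y + 1)%Z by lia.
rewrite plus_IZR; ring.
Qed.

Lemma z_periodic (G : arcs) (phi : R) : z G (phi + 2 * PI) = z G phi.
Proof. unfold z; now rewrite reduce_angle_periodic. Qed.

Lemma angle_mono (G : arcs) : circular_polygon G ->
  forall i j : nat, (i <= j <= nb_arcs G)%nat -> angle G i <= angle G j.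
Proof.
intros HG i j [Hij Hj]; induction j as [|j IH].
- replace i with 0%nat by lia; lra.
- destruct (Nat.eq_dec i (S j)) as [->|e]; [lra|].
  apply Rle_trans with (angle G j); [apply IH; lia|].
  apply Rlt_le, (cp_angle _ HG); lia.
Qed.

Lemma z_arc (G : arcs) : circular_polygon G ->
  forall (j : nat) (phi : R), (j < nb_arcs G)%nat ->
  angle G j <= phi <= angle G (S j) ->
  z G phi = Cplus (center G j) (Cmult (RtoC (radius G j)) (cis phi)).
Proof.
intros HG.
assert (Hopen : forall (j : nat) (phi : R), (j < nb_arcs G)%nat ->
  angle G j <= phi < angle G (S j) ->
  z G phi = Cplus (center G j) (Cmult (RtoC (radius G j)) (cis phi))).
{ intros j phi Hj Hphi; unfold z; cbv zeta.
  rewrite reduce_angle_id.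
  2:{ rewrite <- (cp_turn _ HG); split.
      - apply Rle_trans with (angle G j); [apply angle_mono; [easy|lia]|lra].
      - apply Rlt_le_trans with (angle G (S j)); [lra|apply angle_mono; [easy|lia]]. }
  replace (cell (angle G) (nb_arcs G - 1) phi) with j; [easy|].
  symmetry; apply cell_eq; [|lia|lra|intros; lra].
  intros i Hi; apply Rlt_le, (cp_angle _ HG); lia. }
intros j phi Hj Hphi.
destruct (Rlt_dec phi (angle G (S j))) as [H|H]; [apply Hopen; [easy|lra]|].
replace phi with (angle G (S j)) by lra.
pose proof (cp_node _ HG j Hj) as Hn; cbv zeta in Hn; rewrite Hn.
destruct (Nat.eq_dec (S j) (nb_arcs G)) as [e|e].
- rewrite e, Nat.Div0.mod_same, (cp_turn _ HG), z_periodic, cis_periodic.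
  apply Hopen; [lia|].
  split; [lra|]; apply (cp_angle _ HG); lia.
- rewrite Nat.mod_small by lia.
  apply Hopen; [lia|].
  split; [lra|]; apply (cp_angle _ HG); lia.
Qed.

Lemma arclength_arc (G : arcs) : circular_polygon G ->
  forall (j : nat) (phi : R), (j < nb_arcs G)%nat ->
  angle G j <= phi <= angle G (S j) ->
  is_RInt (speed G) (angle G j) phi (radius G j * (phi - angle G j)).
Proof.
intros HG j phi Hj Hphi.
pose proof (cp_radius _ HG j Hj) as Hr.
apply is_RInt_ext with (fun _ => radius G j).
- rewrite Rmin_left, Rmax_right by lra; intros x Hx.
  unfold speed.
  assert (Hloc : locally x (fun t =>
      z G t = Cplus (center G j) (Cmult (RtoC (radius G j)) (cis t)))).
  { apply filter_imp with (fun t => angle G j < t < phi).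
    - intros t Ht; apply z_arc; [easy|easy|lra].
    - apply (open_and _ _ (open_gt (angle G j)) (open_lt phi)); lra. }
  rewrite (Derive_ext_loc (fun t => fst (z G t))
    (fun t => fst (center G j) + radius G j * cos t)).
  2:{ revert Hloc; apply filter_imp; intros t ->; simpl; ring. }
  rewrite (Derive_ext_loc (fun t => snd (z G t))
    (fun t => snd (center G j) + radius G j * sin t)).
  2:{ revert Hloc; apply filter_imp; intros t ->; simpl; ring. }
  rewrite (is_derive_unique _ _ (- radius G j * sin x))
    by (auto_derive; [easy|ring]).
  rewrite (is_derive_unique _ _ (radius G j * cos x))
    by (auto_derive; [easy|ring]).
  unfold Cmod; simpl fst; simpl snd.
  transitivity (sqrt (Rsqr (radius G j) * (Rsqr (sin x) + Rsqr (cos x)))).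
  + rewrite sin2_cos2, Rmult_1_r, sqrt_Rsqr; [easy|lra].
  + f_equal; unfold Rsqr; ring.
- replace (radius G j * (phi - angle G j)) with (scal (phi - angle G j) (radius G j))
    by (unfold scal; simpl; unfold mult; simpl; ring).
  apply (is_RInt_const (V := R_NormedModule)).
Qed.

Fixpoint arclength_sum (G : arcs) (j : nat) : R :=
  match j with O => 0
  | S i => arclength_sum G i + radius G i * (angle G (S i) - angle G i) end.

Lemma arclength_node (G : arcs) : circular_polygon G ->
  forall j, (j <= nb_arcs G)%nat -> is_RInt (speed G) (angle G 0) (angle G j) (arclength_sum G j).
Proof.
intros HG; induction j as [|j IH]; intros Hj.
- apply (is_RInt_point (V := R_NormedModule)).
- apply (is_RInt_Chasles (V := R_NormedModule)) with (angle G j); [apply IH; lia|].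
  apply arclength_arc; [easy|lia|].
  pose proof (cp_angle _ HG j Hj); lra.
Qed.

Lemma perimeter_eq (G : arcs) : circular_polygon G -> perimeter G = arclength_sum G (nb_arcs G).
Proof. intros HG; unfold perimeter, arclength; rewrite <- (cp_turn _ HG).
apply is_RInt_unique, arclength_node; auto. Qed.

Lemma arclength_angle (G : arcs) : circular_polygon G ->
  forall j, (j <= nb_arcs G)%nat -> arclength G (angle G j) = arclength_sum G j.
Proof. intros; apply is_RInt_unique, arclength_node; auto. Qed.

Lemma curvature_arc (G : arcs) : circular_polygon G ->
  forall (j : nat) (phi : R), (j < nb_arcs G)%nat ->
  angle G j <= phi < angle G (S j) ->
  curvature G (arclength G phi) = / radius G j.
Proof.
intros HG j phi Hj Hphi; unfold curvature; do 2 f_equal.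
assert (Hl : arclength G phi = arclength_sum G j + radius G j * (phi - angle G j)).
{ apply is_RInt_unique, (is_RInt_Chasles (V := R_NormedModule)) with (angle G j).
  apply arclength_node; auto; lia.
  apply arclength_arc; auto; lra. }
pose proof (cp_radius _ HG j Hj) as Hr.
apply cell_eq; [|lia| |].
- intros i Hi; rewrite !arclength_angle by (auto; lia); simpl.
  pose proof (cp_radius _ HG i ltac:(lia)); pose proof (cp_angle _ HG i ltac:(lia)); nra.
- rewrite arclength_angle, Hl by (auto; lia); nra.
- intros _; rewrite arclength_angle, Hl by (auto; lia); simpl; nra.
Qed.

(* Main.v *)
Require Import Defs.
From Stdlib Require Import Reals Lra Lia Ranalysis5 IndefiniteDescription.
From Coquelicot Require Import Coquelicot.
Open Scope R_scope.

(* Between two consecutive nodes a billiard trajectory keeps the same angle of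
   incidence.  If it crosses a node from an arc of radius r, with angle th, to
   an arc of radius s, with angle th', its chord makes with the tangent at the
   node an angle be such that (s - r) cos be = s cos th' - r cos th.  Hence a
   one-turn trajectory with n_j impacts at angle th_j on the arc j, of angular
   width d_j, amounts to a solution of
     2 n_j th_j = d_j + be_(j+1) - be_j,
   and its length is the sum of r_j (2 n_j sin th_j + sin be_j - sin be_(j+1)).
   When the n_j are of order q, the right-hand side is d_j + O(1/q) with
   derivative O(1), so that the equation has a solution by contraction, as long
   as every th_(j+1) / th_j stays between 1 and sqrt (r_j / r_(j+1)), strictly
   away from the second bound.  Taking n_j close to a multiple of
   d_j ((1 - t) + t r_j^(1/3)), with 0 <= t <= 1, meets this condition up to a
   correction of relative size 1/q, and Taylor expansion gives
   L = |Gamma| + c(t) / q^2 + O(1/q^3), where c is continuous,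
   c(0) = - pi^2 |Gamma| / 6 and c(1) = c_+. *)

(** * Crossing a node *)

Lemma sin_bounds (x : R) : 0 <= x <= 1 ->
  x - x ^ 3 / 6 <= sin x <= x - x ^ 3 / 6 + x ^ 5 / 120.
Proof.
intros Hx; destruct (pre_sin_bound x 0) as [H1 H2]; [lra|lra|].
unfold sin_approx, sin_term in *; simpl in *; lra.
Qed.

Lemma cos_bounds (x : R) : 0 <= x <= 1 ->
  1 - x ^ 2 / 2 <= cos x <= 1 - x ^ 2 / 2 + x ^ 4 / 24.
Proof.
intros Hx; destruct (pre_cos_bound x 0) as [H1 H2]; [lra|lra|].
unfold cos_approx, cos_term in *; simpl in *; lra.
Qed.

Lemma sin_ge_half (x : R) : 0 <= x <= 1 -> x / 2 <= sin x.
Proof.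
intros Hx; destruct (sin_bounds x Hx) as [H _].
assert (0 <= x * (1 - x * x)) by (apply Rmult_le_pos; nra); nra.
Qed.

Lemma cos_decr_mvt (x y : R) : x <= y ->
  exists c, x <= c <= y /\ cos x - cos y = sin c * (y - x).
Proof.
intros Hxy.
destruct (MVT_gen cos x y (fun t => - sin t)) as [c [Hc1 Hc2]].
- intros t _; auto_derive; [easy|ring].
- intros t _; apply continuity_cos.
- exists c; split.
  + rewrite Rmin_left, Rmax_right in Hc1 by lra; lra.
  + lra.
Qed.

(** On [0, M] the derivative of cos is at most [M] in absolute value. This gain over the constant 1
    is essential: for angles of order 1/q it compensates the loss in inverting the cosine. *)
Lemma cos_lipschitz (M x y : R) : 0 <= x <= M -> 0 <= y <= M -> M <= 1 ->
  Rabs (cos x - cos y) <= M * Rabs (x - y).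
Proof.
intros Hx Hy HM.
assert (Hle : forall x y, 0 <= x -> x <= y -> y <= M ->
  Rabs (cos x - cos y) <= M * Rabs (x - y)).
{ clear x y Hx Hy; intros x y H1 H2 H3.
  destruct (cos_decr_mvt x y H2) as [c [Hc ->]].
  destruct (sin_bounds c) as [_ Hs]; [lra|].
  pose proof (sin_ge_half c ltac:(lra)).
  assert (sin c <= M).
  { assert (0 <= c ^ 3 * (20 - c ^ 2)).
    { apply Rmult_le_pos; [apply pow_le; lra|nra]. }
    assert (c ^ 5 = c ^ 3 * c ^ 2) by ring. nra. }
  rewrite Rabs_mult, Rabs_minus_sym, (Rabs_right (sin c)) by lra.
  apply Rmult_le_compat_r; [apply Rabs_pos|easy]. }
destruct (Rle_dec x y); [apply Hle; lra|].
rewrite Rabs_minus_sym, (Rabs_minus_sym x); apply Hle; lra.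
Qed.

(** Controls the loss when an angle is recovered from its cosine: above [m] the derivative of cos is
    at least [m / 2] in absolute value. *)
Lemma cos_expanding (m x y : R) : 0 <= m -> m <= x <= 1 -> m <= y <= 1 ->
  m / 2 * Rabs (x - y) <= Rabs (cos x - cos y).
Proof.
intros Hm Hx Hy.
assert (Hle : forall x y, m <= x -> x <= y -> y <= 1 ->
  m / 2 * Rabs (x - y) <= Rabs (cos x - cos y)).
{ clear x y Hx Hy; intros x y H1 H2 H3.
  destruct (cos_decr_mvt x y H2) as [c [Hc ->]].
  pose proof (sin_ge_half c ltac:(lra)).
  rewrite Rabs_mult, Rabs_minus_sym, (Rabs_right (sin c)) by lra.
  apply Rmult_le_compat_r; [apply Rabs_pos|lra]. }
destruct (Rle_dec x y); [apply Hle; lra|].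
rewrite Rabs_minus_sym, (Rabs_minus_sym (cos x)); apply Hle; lra.
Qed.

(* A chord joining two arcs of radii r and s, which it leaves and meets at
   angles th and th', makes the angle [turn r s th th'] with the tangent at
   their common node. *)
Definition turn (r s th th' : R) : R :=
  acos ((s * cos th' - r * cos th) / (s - r)).

(** To second order the angle be at the node satisfies (s - r) be^2 = s th'^2 - r th^2. The margin
    [c] keeps be away from 0; giving the larger angle to the smaller radius keeps be below both
    angles. *)
Definition crossable (c r s th th' : R) : Prop :=
  0 < th <= 1 /\ 0 < th' <= 1 /\
  ((s < r /\ th <= th' /\ s * th' ^ 2 <= (1 - c) * (r * th ^ 2)) \/
   (r < s /\ th' <= th /\ r * th ^ 2 <= (1 - c) * (s * th' ^ 2))).

Lemma turn_sym (r s th th' : R) : r <> s -> turn r s th th' = turn s r th' th.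
Proof. intros H; unfold turn; f_equal; field; lra. Qed.

(** The upper bound comes from r cos th - s cos th' >= (r - s) cos th. For the lower one, the margin
    [c] shows in the second-order expansion, and [th ^ 2 <= 6 * c] absorbs the quartic term. *)
Lemma turn_spec_lt (c r s th th' : R) :
  0 < s < r -> 0 < th <= th' -> th' <= 1 -> 0 < c <= 1 -> th ^ 2 <= 6 * c ->
  s * th' ^ 2 <= (1 - c) * (r * th ^ 2) ->
  cos (turn r s th th') = (s * cos th' - r * cos th) / (s - r) /\
  0 <= turn r s th th' <= th /\ c * th ^ 2 <= 2 * turn r s th th' ^ 2.
Proof.
intros Hr Hth Hth' Hc Hc6 Hrat; unfold turn.
set (X := (s * cos th' - r * cos th) / (s - r)).
assert (HX : X * (r - s) = r * cos th - s * cos th') by (unfold X; field; lra).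
destruct (cos_bounds th) as [Hc1 Hc2]; [lra|].
destruct (cos_bounds th') as [Hd1 Hd2]; [lra|].
assert (Hmono : cos th' <= cos th).
{ pose proof PI2_1; apply cos_decr_1; lra. }
pose proof (COS_bound th) as [_ Hct].
assert (Hlo : cos th <= X) by nra.
assert (Hhi : c * th ^ 2 / 4 <= 1 - X).
{ assert (H1 : (r - s) * (1 - X) >= r * (th ^ 2 / 2 - th ^ 4 / 24) - s * (th' ^ 2 / 2)).
  { assert (r * (th ^ 2 / 2 - th ^ 4 / 24) <= r * (1 - cos th)) by (apply Rmult_le_compat_l; lra).
    assert (s * (1 - cos th') <= s * (th' ^ 2 / 2)) by (apply Rmult_le_compat_l; lra).
    lra. }
  assert (H2 : th ^ 4 <= 6 * c * th ^ 2).
  { replace (th ^ 4) with (th ^ 2 * th ^ 2) by ring; apply Rmult_le_compat_r; nra. }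
  assert (H3 : (r - s) * (1 - X) >= r * (c * th ^ 2 / 4)).
  { assert (r * th ^ 4 <= r * (6 * c * th ^ 2)) by (apply Rmult_le_compat_l; lra). lra. }
  assert (0 <= c * th ^ 2) by nra.
  apply Rmult_le_reg_l with (r - s); nra. }
assert (0 <= c * th ^ 2) by nra.
pose proof (COS_bound th) as [Hm1 _].
assert (Hcos : cos (acos X) = X) by (apply cos_acos; lra).
pose proof (acos_bound X) as Hab.
assert (Hle : acos X <= th).
{ destruct (Rle_dec (acos X) th) as [|n]; [easy|].
  assert (cos (acos X) < cos th); [|lra].
  pose proof PI2_1; apply cos_decreasing_1; lra. }
repeat split; [easy|lra|easy|].
destruct (cos_bounds (acos X)) as [He1 _]; [lra|]; lra.
Qed.

(** Merges the two orders of the radii by symmetry. Which angle is the smaller depends on that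
    order, hence a common lower bound [m] of both. *)
Lemma turn_spec (c r s th th' : R) : 0 < r -> 0 < s ->
  crossable c r s th th' -> 0 < c <= 1 -> th ^ 2 <= 6 * c -> th' ^ 2 <= 6 * c ->
  (s - r) * cos (turn r s th th') = s * cos th' - r * cos th /\
  0 <= turn r s th th' <= th /\ turn r s th th' <= th' /\
  forall m, 0 <= m <= th -> m <= th' -> c * m ^ 2 <= 2 * turn r s th th' ^ 2.
Proof.
intros Hr Hs (Ht & Ht' & [(H1 & H2 & H3) | (H1 & H2 & H3)]) Hc H6 H6'.
- destruct (turn_spec_lt c r s th th') as (E1 & E2 & E3); try easy; try lra.
  repeat split; try lra; [rewrite E1; field; lra|].
  intros m Hm Hm'; apply Rle_trans with (2 := E3), Rmult_le_compat_l; [lra|].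
  apply pow_incr; lra.
- rewrite turn_sym by lra.
  destruct (turn_spec_lt c s r th' th) as (E1 & E2 & E3); try easy; try lra.
  repeat split; try lra; [rewrite E1; field; lra|].
  intros m Hm Hm'; apply Rle_trans with (2 := E3), Rmult_le_compat_l; [lra|].
  apply pow_incr; lra.
Qed.

(** The two cosines vary by at most [M * d], solving for the cosine at the node costs a factor [Lr],
    and inverting it above [m] costs 2/m. The values used later for [M] and [m] are both of order
    1/q, so the constant stays bounded. *)
Lemma turn_lipschitz (m M Lr d r s a a' b b' : R) :
  0 < r -> 0 < s -> r <> s -> r + s <= Lr * Rabs (r - s) -> 0 < m -> M <= 1 ->
  0 <= a <= M -> 0 <= a' <= M -> 0 <= b <= M -> 0 <= b' <= M ->
  (s - r) * cos (turn r s a a') = s * cos a' - r * cos a ->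
  (s - r) * cos (turn r s b b') = s * cos b' - r * cos b ->
  m <= turn r s a a' <= 1 -> m <= turn r s b b' <= 1 ->
  Rabs (a - b) <= d -> Rabs (a' - b') <= d ->
  Rabs (turn r s a a' - turn r s b b') <= 2 * Lr * M / m * d.
Proof.
intros Hr Hs Hrs HL Hm HM Ha Ha' Hb Hb' Ea Eb Hta Htb Hd Hd'.
set (x := turn r s a a') in *; set (y := turn r s b b') in *.
pose proof (cos_expanding m x y ltac:(lra) Hta Htb) as H1.
pose proof (cos_lipschitz M a b Ha Hb HM) as H2.
pose proof (cos_lipschitz M a' b' Ha' Hb' HM) as H3.
assert (Hp : 0 < Rabs (r - s)) by (apply Rabs_pos_lt; lra).
assert (H4 : Rabs (r - s) * Rabs (cos x - cos y) <= (r + s) * (M * d)).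
{ rewrite <- Rabs_mult.
  replace ((r - s) * (cos x - cos y)) with
    (r * (cos a - cos b) + s * (cos b' - cos a')) by lra.
  apply Rle_trans with (1 := Rabs_triang _ _).
  rewrite !Rabs_mult, (Rabs_right r), (Rabs_right s) by lra.
  rewrite (Rabs_minus_sym (cos b')).
  assert (M * Rabs (a - b) <= M * d) by (apply Rmult_le_compat_l; lra).
  assert (M * Rabs (a' - b') <= M * d) by (apply Rmult_le_compat_l; lra).
  rewrite Rmult_plus_distr_r.
  apply Rplus_le_compat; apply Rmult_le_compat_l; lra. }
assert (Hd0 : 0 <= d) by (pose proof (Rabs_pos (a - b)); lra).
assert (H5 : Rabs (cos x - cos y) <= Lr * (M * d)).
{ apply Rmult_le_reg_l with (Rabs (r - s)); [easy|].
  apply Rle_trans with (1 := H4).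
  replace (Rabs (r - s) * (Lr * (M * d))) with (Lr * Rabs (r - s) * (M * d)) by ring.
  apply Rmult_le_compat_r; [apply Rmult_le_pos; lra|easy]. }
apply Rmult_le_reg_l with (m / 2); [lra|].
replace (m / 2 * (2 * Lr * M / m * d)) with (Lr * (M * d)) by (field; lra).
lra.
Qed.

(** * Contractions of a product of intervals *)

(** Banach's iteration in the sup norm of the first [k] coordinates, started at the corner [lo].
    Points are functions on [nat], so the fixed point is only claimed at indices below [k]. *)
Lemma box_fixed_point (k : nat) (lo hi : nat -> R) (T : (nat -> R) -> nat -> R) :
  let box x := forall j, (j < k)%nat -> lo j <= x j <= hi j in
  (forall j, (j < k)%nat -> lo j <= hi j) ->
  (forall x, box x -> box (T x)) ->
  (forall x y d, box x -> box y ->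
     (forall j, (j < k)%nat -> Rabs (x j - y j) <= d) ->
     forall j, (j < k)%nat -> Rabs (T x j - T y j) <= d / 2) ->
  exists x, box x /\ forall j, (j < k)%nat -> T x j = x j.
Proof.
intros box Hlh HT HL.
set (X := fix X n := match n with O => lo | S n => T (X n) end).
assert (HX : forall n, box (X n)).
{ induction n; simpl; [intros j Hj; specialize (Hlh j Hj); lra|now apply HT]. }
assert (HD : exists D, forall j, (j < k)%nat -> hi j - lo j <= D).
{ clear; induction k as [|k [D HD]]; [exists 0; lia|].
  exists (Rmax D (hi k - lo k)); intros j Hj.
  destruct (Nat.eq_dec j k) as [->|]; [apply Rmax_r|].
  apply Rle_trans with D; [apply HD; lia|apply Rmax_l]. }
destruct HD as [D HD].
assert (Hgeo : forall n m j, (j < k)%nat -> Rabs (X (n + m)%nat j - X n j) <= D * (/ 2) ^ n).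
{ induction n as [|n IH]; intros m j Hj.
  - simpl X; simpl pow; rewrite Rmult_1_r.
    specialize (HX m j Hj); specialize (HD j Hj); apply Rabs_le; lra.
  - simpl X; replace (D * (/ 2) ^ S n) with (D * (/ 2) ^ n / 2) by (simpl; field).
    apply HL; auto. }
assert (Hpow : forall e : posreal, exists n, D * (/ 2) ^ n < e).
{ intros e.
  (* [1 + Rabs D] is a positive substitute for [D], whose sign is not known. *)
  destruct (pow_lt_1_zero (/ 2)) with (y := e / (1 + Rabs D)) as [n Hn].
  - rewrite Rabs_right; lra.
  - apply Rdiv_lt_0_compat; [apply cond_pos|pose proof (Rabs_pos D); lra].
  - exists n; specialize (Hn n (Nat.le_refl n)).
    pose proof (Rabs_pos D); pose proof (Rle_abs D).
    rewrite Rabs_right in Hn by (apply Rle_ge, pow_le; lra).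
    assert (0 < (/ 2) ^ n) by (apply pow_lt; lra).
    assert ((1 + Rabs D) * (/ 2) ^ n < e).
    { apply Rmult_lt_reg_r with (/ (1 + Rabs D)); [apply Rinv_0_lt_compat; lra|].
      replace ((1 + Rabs D) * (/ 2) ^ n * / (1 + Rabs D)) with ((/ 2) ^ n) by (field; lra).
      exact Hn. }
    nra. }
set (x := fun j => real (Lim_seq (fun n => X n j))).
assert (Hx : forall j, (j < k)%nat -> is_lim_seq (fun n => X n j) (x j)).
{ intros j Hj; apply Lim_seq_correct', ex_lim_seq_cauchy_corr.
  intros e; destruct (Hpow (mkposreal _ (is_pos_div_2 e))) as [n0 Hn0]; simpl in Hn0.
  exists n0; intros n m Hn Hm.
  replace n with (n0 + (n - n0))%nat by lia; replace m with (n0 + (m - n0))%nat by lia.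
  pose proof (Hgeo n0 (n - n0)%nat j Hj); pose proof (Hgeo n0 (m - n0)%nat j Hj).
  replace (X (n0 + (n - n0))%nat j - X (n0 + (m - n0))%nat j) with
   ((X (n0 + (n - n0))%nat j - X n0 j) - (X (n0 + (m - n0))%nat j - X n0 j)) by ring.
  apply Rle_lt_trans with (1 := Rabs_triang _ _); rewrite Rabs_Ropp; lra. }
assert (Hbox : box x).
{ intros j Hj; split.
  - apply (is_lim_seq_le (fun _ => lo j) (fun n => X n j) (lo j) (x j)); auto.
    + intros n; now apply HX.
    + apply is_lim_seq_const.
  - apply (is_lim_seq_le (fun n => X n j) (fun _ => hi j) (x j) (hi j)); auto.
    + intros n; now apply HX.
    + apply is_lim_seq_const. }
assert (Hlim : forall n j, (j < k)%nat -> Rabs (x j - X n j) <= D * (/ 2) ^ n).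
{ intros n j Hj.
  apply (is_lim_seq_le (fun m => Rabs (X (m + n)%nat j - X n j)) (fun _ => D * (/ 2) ^ n)
    (Rabs (x j - X n j)) (D * (/ 2) ^ n)).
  - intros m; rewrite Nat.add_comm; auto.
  - apply (is_lim_seq_abs _ (x j - X n j)).
    apply (is_lim_seq_minus' _ (fun _ => X n j)); [|apply is_lim_seq_const].
    apply (is_lim_seq_incr_n (fun m => X m j)); auto.
  - apply is_lim_seq_const. }
exists x; split; [easy|].
intros j Hj.
(* Comparing [T x] and [x] with [X (S n)] bounds the defect by [D * (/ 2) ^ n], which for large [n]
   is less than half the defect itself. *)
apply Rminus_diag_uniq; destruct (Req_dec (T x j - x j) 0) as [e|ne]; [easy|exfalso].
assert (He : 0 < Rabs (T x j - x j) / 2) by (apply Rabs_pos_lt in ne; lra).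
destruct (Hpow (mkposreal _ He)) as [n Hn]; simpl in Hn.
pose proof (HL x (X n) _ Hbox (HX n) (Hlim n) j Hj) as H1.
pose proof (Hlim (S n) j Hj) as H2; simpl X in H2; simpl pow in H2.
pose proof (Rabs_triang (T x j - T (X n) j) (T (X n) j - x j)) as H3.
replace (T x j - T (X n) j + (T (X n) j - x j)) with (T x j - x j) in H3 by ring.
rewrite (Rabs_minus_sym (T (X n) j)) in H3; lra.
Qed.

(** * From angles of incidence to a periodic trajectory *)

Fixpoint rsum (f : nat -> R) (k : nat) : R :=
  match k with O => 0 | S j => rsum f j + f j end.

Lemma rsum_le (f g : nat -> R) (k : nat) :
  (forall j, (j < k)%nat -> f j <= g j) -> rsum f k <= rsum g k.
Proof.
induction k as [|k IH]; intros H; simpl; [lra|].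
apply Rplus_le_compat; [apply IH; intros; apply H; lia|apply H; lia].
Qed.

Lemma rsum_scal (c : R) (f : nat -> R) (k : nat) :
  rsum (fun j => c * f j) k = c * rsum f k.
Proof. induction k as [|k IH]; simpl; [ring|rewrite IH; ring]. Qed.

Lemma rsum_ext (f g : nat -> R) (k : nat) :
  (forall j, (j < k)%nat -> f j = g j) -> rsum f k = rsum g k.
Proof.
induction k as [|k IH]; intros H; simpl; [easy|].
rewrite H, IH; [easy|intros; apply H; lia|lia].
Qed.

Lemma rsum_minus (f g : nat -> R) (k : nat) :
  rsum (fun j => f j - g j) k = rsum f k - rsum g k.
Proof. induction k as [|k IH]; simpl; [ring|rewrite IH; ring]. Qed.

Lemma rsum_telescope (a : nat -> R) (k : nat) :
  rsum (fun j => a (S j) - a j) k = a k - a 0%nat.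
Proof. induction k as [|k IH]; simpl; [ring|rewrite IH; ring]. Qed.

Lemma rsum_ge_term (f : nat -> R) (k i : nat) : (forall j, (j < k)%nat -> 0 <= f j) ->
  (i < k)%nat -> f i <= rsum f k.
Proof.
induction k as [|k IH]; intros H Hi; [lia|simpl].
assert (H0 : 0 <= rsum f k).
{ replace 0 with (rsum (fun _ => 0) k).
  - apply rsum_le; intros; apply H; lia.
  - clear; induction k as [|k IH]; simpl; [easy|rewrite IH; ring]. }
destruct (Nat.eq_dec i k) as [->|]; [lra|].
assert (f i <= rsum f k) by (apply IH; [intros; apply H; lia|lia]).
pose proof (H k ltac:(lia)); lra.
Qed.

Lemma mod_lt (k j : nat) : (1 < k)%nat -> (j mod k < k)%nat.
Proof. intros; apply Nat.mod_upper_bound; lia. Qed.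

(** Angles are lifted: beyond the last node they exceed those of arc 0 by 2 pi, which periodicity
    removes. *)
Lemma z_arc_next (G : arcs) : circular_polygon G ->
  forall (j : nat) (phi : R), (j < nb_arcs G)%nat ->
  let j' := (S j mod nb_arcs G)%nat in
  angle G (S j) <= phi <= angle G (S j) + (angle G (S j') - angle G j') ->
  z G phi = Cplus (center G j') (Cmult (RtoC (radius G j')) (cis phi)).
Proof.
intros HG j phi Hj j' Hphi; subst j'.
destruct (Nat.eq_dec (S j) (nb_arcs G)) as [e|e].
- rewrite e, Nat.Div0.mod_same, (cp_turn _ HG) in *.
  replace phi with (phi - 2 * PI + 2 * PI) by ring.
  rewrite z_periodic, cis_periodic; apply z_arc; [easy|lia|lra].
- rewrite Nat.mod_small in * by lia; apply z_arc; [easy|lia|lra].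
Qed.

(* The point [cO + r e^{ib} = cO' + s e^{ib}] is the node; [b + al] is the
   direction of the chord, up to a quarter turn. *)
Lemma chord_across_node (cO cO' : C) (r s b al th th' : R) :
  Cplus cO (Cmult (RtoC r) (cis b)) = Cplus cO' (Cmult (RtoC s) (cis b)) ->
  (s - r) * cos al = s * cos th' - r * cos th ->
  Cplus cO' (Cmult (RtoC s) (cis (b + al + th'))) =
  Cplus (Cplus cO (Cmult (RtoC r) (cis (b + al - th))))
    (Cmult (RtoC (s * (sin th' + sin al) + r * (sin th - sin al)))
       (tangent (b + al))).
Proof.
intros Hn Ha.
unfold cis, tangent, Cplus, Cmult, RtoC, Ci in *; simpl in *.
injection Hn as Hx Hy.
rewrite !cos_plus, !sin_plus, cos_minus, sin_minus, !cos_plus, !sin_plus.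
pose proof (sin2_cos2 al) as Hal; unfold Rsqr in Hal.
set (C := cos b) in *; set (S := sin b) in *.
f_equal.
- replace (fst cO') with (fst cO + (r - s) * C) by lra.
  apply Rminus_diag_uniq.
  (* The difference of the two sides is an explicit combination of [Ha] and of sin^2 + cos^2 = 1 at
     [al]. *)
  replace (_ - _) with
   ((C * cos al - S * sin al) * (s * cos th' - r * cos th - (s - r) * cos al)
    + (r - s) * C * (1 - (sin al * sin al + cos al * cos al))) by ring.
  rewrite Hal, Ha; ring.
- replace (snd cO') with (snd cO + (r - s) * S) by lra.
  apply Rminus_diag_uniq.
  replace (_ - _) with
   ((C * sin al + S * cos al) * (s * cos th' - r * cos th - (s - r) * cos al)
    + (r - s) * S * (1 - (sin al * sin al + cos al * cos al))) by ring.
  rewrite Hal, Ha; ring.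
Qed.

Lemma Cmod_tangent (t phi : R) : 0 <= t -> Cmod (Cmult (RtoC t) (tangent phi)) = t.
Proof.
intros Ht; rewrite Cmod_mult, Cmod_R, Rabs_right by lra.
unfold tangent; rewrite Cmod_mult.
replace (Cmod Ci) with 1; [replace (Cmod (cis phi)) with 1; [ring|]|].
- unfold Cmod, cis; simpl; symmetry; rewrite !Rmult_1_r.
  pose proof (sin2_cos2 phi) as H; unfold Rsqr in H; rewrite Rplus_comm, H; apply sqrt_1.
- unfold Cmod, Ci; simpl; transitivity (sqrt 1); [now rewrite sqrt_1|f_equal; ring].
Qed.

Lemma cis_tangent (t phi : R) : Cmult (cis t) (tangent phi) = tangent (phi + t).
Proof.
unfold tangent, cis, Cmult, Ci; simpl; rewrite cos_plus, sin_plus; apply (f_equal2 pair); ring.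
Qed.

Lemma sum_n_telescope (F : nat -> R) (n : nat) :
  sum_n (fun i => F (S i) - F i) n = F (S n) - F 0%nat.
Proof.
induction n as [|n IH]; [now rewrite sum_O|].
rewrite sum_Sn, IH; unfold plus; simpl; ring.
Qed.

Section Trajectory.

Variables (G : arcs) (HG : circular_polygon G).
Let k := nb_arcs G.
Let nx (j : nat) := (S j mod k)%nat.
(** Arc [j] receives the impacts numbered from [N j] to [N (S j) - 1], all at angle [th j]; [be j]
    is the angle between the tangent at the node where arc [j] starts and the chord crossing it. *)
Variables (N : nat -> nat) (th be : nat -> R).
Hypothesis N0 : N 0%nat = 0%nat.
Hypothesis Nincr : forall j, (j < k)%nat -> (N j < N (S j))%nat.
Hypothesis th_bound : forall j, (j < k)%nat -> 0 < th j <= 1.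
Hypothesis be_pos : forall j, (j <= k)%nat -> 0 <= be j.
Hypothesis be_le : forall j, (j < k)%nat -> be (S j) <= th j.
Hypothesis be_turn : be k = be 0%nat.
(** The first impact on arc [j] is at [angle G j + be j + th j], the last at
    [angle G (S j) + be (S j) - th j], and consecutive ones are [2 * th j] apart. *)
Hypothesis closing : forall j, (j < k)%nat ->
  2 * (INR (N (S j)) - INR (N j)) * th j = angle G (S j) - angle G j + be (S j) - be j.
Hypothesis node_eq : forall j, (j < k)%nat ->
  (radius G (nx j) - radius G j) * cos (be (S j)) =
  radius G (nx j) * cos (th (nx j)) - radius G j * cos (th j).

(** Searching up to [k] rather than [k - 1] puts the time [N k] on arc [k], that is, on arc 0 one
    turn later; hence the reductions modulo [k] below. *)
Let arc (n : nat) : nat := cell (fun j => INR (N j)) k (INR n).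

Let step_index (n j : nat) : R := 2 * (INR n - INR (N j)) + 1.

Let orbit (n : nat) : R * R :=
  let j := arc n in
  (angle G j + be j + th (j mod k)%nat * step_index n j, th (j mod k)%nat).

Let arc_length_term (j : nat) : R :=
  radius G j * (2 * (INR (N (S j)) - INR (N j)) * sin (th j) + sin (be j) - sin (be (S j))).

(** A primitive of the length along the orbit: its increments are the lengths of the successive
    chords, across nodes as well. *)
Let partial_length (n : nat) : R :=
  let j := arc n in
  rsum arc_length_term j +
  radius G (j mod k)%nat * (sin (be j) + sin (th (j mod k)%nat) * step_index n j).

Lemma arc_eq (n j : nat) : (j < k)%nat -> (N j <= n < N (S j))%nat -> arc n = j.
Proof.
intros Hj Hn; apply cell_eq; [|lia| |].
- intros i Hi; apply le_INR; pose proof (Nincr i Hi); lia.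
- apply le_INR; lia.
- intros _; apply lt_INR; lia.
Qed.

Lemma arc_last : arc (N k) = k.
Proof.
apply cell_eq; [|lia|lra|lia].
intros i Hi; apply le_INR; pose proof (Nincr i Hi); lia.
Qed.

Lemma arc_exists (n : nat) : (n < N k)%nat ->
  exists j, (j < k)%nat /\ (N j <= n < N (S j))%nat.
Proof.
assert (H : forall m, (m <= k)%nat -> (n < N m)%nat ->
  exists j, (j < m)%nat /\ (N j <= n < N (S j))%nat).
{ induction m as [|m IH]; intros Hm Hn; [lia|].
  destruct (Nat.lt_ge_cases n (N m)) as [H|H].
  - destruct IH as [j [Hj1 Hj2]]; [lia|easy|exists j; split; [lia|easy]].
  - exists m; lia. }
intros Hn; destruct (H k (Nat.le_refl k) Hn) as [j Hj]; now exists j.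
Qed.

Lemma orbit_in_arc (n j : nat) : (j < k)%nat -> (N j <= n < N (S j))%nat ->
  orbit n = (angle G j + be j + th j * step_index n j, th j) /\
  partial_length n = rsum arc_length_term j +
    radius G j * (sin (be j) + sin (th j) * step_index n j).
Proof.
intros Hj Hn; unfold orbit, partial_length.
rewrite (arc_eq n j Hj Hn); cbv zeta; rewrite Nat.mod_small by easy; easy.
Qed.

Lemma orbit_next_arc (j : nat) : (j < k)%nat ->
  orbit (N (S j)) = (angle G (S j) + be (S j) + th (nx j), th (nx j)) /\
  partial_length (N (S j)) = rsum arc_length_term (S j) +
    radius G (nx j) * (sin (be (S j)) + sin (th (nx j))).
Proof.
intros Hj; unfold orbit, partial_length.
replace (arc (N (S j))) with (S j).
- cbv zeta; unfold step_index; fold (nx j); rewrite Rminus_diag; split; f_equal; ring.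
- destruct (Nat.eq_dec (S j) k) as [->|e]; [symmetry; apply arc_last|].
  symmetry; apply arc_eq; [lia|split; [lia|apply Nincr; lia]].
Qed.

Lemma nx_lt (j : nat) : (nx j < k)%nat.
Proof. apply mod_lt, (cp_nb_arcs _ HG). Qed.

Lemma be_next (j : nat) : (j < k)%nat -> be (nx j) = be (S j).
Proof.
intros Hj; unfold nx; destruct (Nat.eq_dec (S j) k) as [e|e].
- rewrite e, Nat.Div0.mod_same; auto.
- now rewrite Nat.mod_small by lia.
Qed.

(** [be j >= 0] puts the first impact after the node that starts the arc, and [be (S j) <= th j]
    puts the last one before the node that ends it. *)
Lemma orbit_angle_in_arc (n j : nat) : (j < k)%nat -> (N j <= n < N (S j))%nat ->
  angle G j <= angle G j + be j + th j * step_index n j <= angle G (S j).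
Proof.
intros Hj Hn; unfold step_index.
pose proof (closing j Hj) as Hc; pose proof (th_bound j Hj) as Ht.
pose proof (be_pos j ltac:(lia)) as Hb; pose proof (be_le j Hj) as Hb'.
assert (H1 : INR (N j) <= INR n) by (apply le_INR; lia).
assert (H2 : INR n + 1 <= INR (N (S j))) by (rewrite <- S_INR; apply le_INR; lia).
split.
- assert (0 <= th j * (2 * (INR n - INR (N j)) + 1)) by (apply Rmult_le_pos; lra); lra.
- assert (th j * (2 * (INR n - INR (N j)) + 1) <=
          th j * (2 * (INR (N (S j)) - INR (N j)) - 1)) by (apply Rmult_le_compat_l; lra).
  lra.
Qed.

(** A step either crosses the node at the end of arc [j] or stays in the arc. In both cases the
    tangent turns by the sum of the two angles of incidence, and the chord has the intermediate
    direction. *)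
Lemma orbit_step (n : nat) : (n < N k)%nat ->
  exists j t,
    (j < k)%nat /\
    z G (fst (orbit (S n))) =
      Cplus (z G (fst (orbit n))) (Cmult (RtoC t) (tangent (fst (orbit n) + snd (orbit n)))) /\
    0 <= t /\ t = partial_length (S n) - partial_length n /\
    fst (orbit (S n)) = fst (orbit n) + snd (orbit n) + snd (orbit (S n)) /\
    snd (orbit n) = th j /\
    exists j', (j' < k)%nat /\ snd (orbit (S n)) = th j'.
Proof.
intros Hn; destruct (arc_exists n Hn) as [j [Hj Hnj]].
destruct (orbit_in_arc n j Hj Hnj) as [Ho Hp].
pose proof (th_bound j Hj) as Htj.
pose proof (cp_radius _ HG j Hj) as Hr.
pose proof (orbit_angle_in_arc n j Hj Hnj) as Ha.
pose proof PI2_1 as Hpi.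
assert (Hsj : 0 < sin (th j)) by (apply sin_gt_0; lra).
destruct (Nat.eq_dec (S n) (N (S j))) as [e|e].
- destruct (orbit_next_arc j Hj) as [Ho' Hp']; rewrite <- e in Ho', Hp'.
  pose proof (nx_lt j) as Hnx; pose proof (th_bound _ Hnx) as Htn.
  pose proof (cp_radius _ HG _ Hnx) as Hr'.
  pose proof (closing j Hj) as Hc.
  pose proof (be_pos (S j) Hj) as Hb; pose proof (be_le j Hj) as Hb'.
  assert (Hst : angle G j + be j + th j * step_index n j = angle G (S j) + be (S j) - th j).
  { unfold step_index.
    replace (INR n) with (INR (N (S j)) - 1) by (rewrite <- e, S_INR; ring); lra. }
  rewrite Hst in Ho, Ha.
  exists j, (radius G (nx j) * (sin (th (nx j)) + sin (be (S j)))
             + radius G j * (sin (th j) - sin (be (S j)))).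
  rewrite Ho, Ho', Hp, Hp'; cbn [fst snd].
  assert (Hsb : sin (be (S j)) <= sin (th j)) by (apply sin_incr_1; lra).
  assert (0 <= sin (be (S j))) by (apply sin_ge_0; lra).
  assert (0 < sin (th (nx j))) by (apply sin_gt_0; lra).
  repeat split; try easy.
  + rewrite (z_arc G HG j _ Hj Ha).
    rewrite (z_arc_next G HG j _ Hj).
    (* The impact after the node must not overshoot the next arc: that arc has at least one impact,
       so its width is at least 2 th' + be - be', where be' <= th'. *)
    2:{ cbv zeta; fold k; fold (nx j); pose proof (closing _ Hnx) as Hc'.
        pose proof (be_le _ Hnx) as Hb2.
        rewrite (be_next j Hj) in Hc'.
        pose proof (Nincr _ Hnx) as HN.
        assert (INR (N (nx j)) + 1 <= INR (N (S (nx j)))) by (rewrite <- S_INR; apply le_INR; lia).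
        assert (1 * (2 * th (nx j)) <= (INR (N (S (nx j))) - INR (N (nx j))) * (2 * th (nx j)))
          by (apply Rmult_le_compat_r; lra).
        split; lra. }
    cbv zeta; fold k; fold (nx j).
    replace (angle G (S j) + be (S j) - th j + th j) with (angle G (S j) + be (S j)) by ring.
    apply chord_across_node; [|now apply node_eq].
    apply (cp_node _ HG j Hj).
  + apply Rplus_le_le_0_compat; apply Rmult_le_pos; lra.
  + simpl rsum; unfold arc_length_term, step_index.
    replace (INR n) with (INR (N (S j)) - 1) by (rewrite <- e, S_INR; ring); ring.
  + ring.
  + exists (nx j); auto.
- assert (Hnj' : (N j <= S n < N (S j))%nat) by lia.
  destruct (orbit_in_arc (S n) j Hj Hnj') as [Ho' Hp'].
  pose proof (orbit_angle_in_arc _ j Hj Hnj') as Ha'.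
  exists j, (2 * radius G j * sin (th j)).
  rewrite Ho, Ho', Hp, Hp'; cbn [fst snd].
  assert (Hst : step_index (S n) j = step_index n j + 2)
    by (unfold step_index; rewrite S_INR; ring).
  rewrite Hst in *.
  repeat split; try easy.
  + rewrite (z_arc G HG j _ Hj Ha), (z_arc G HG j _ Hj Ha').
    (* A step inside an arc is the degenerate crossing with equal radii and [al = 0], whence the
       form [b + 0]. *)
    set (b := angle G j + be j + th j * step_index n j + th j).
    replace (angle G j + be j + th j * (step_index n j + 2)) with (b + 0 + th j)
      by (unfold b; ring).
    replace (angle G j + be j + th j * step_index n j) with (b + 0 - th j)
      by (unfold b; ring).
    rewrite (chord_across_node (center G j) (center G j) (radius G j) (radius G j) b 0 (th j) (th j));
      [|easy|ring].
    do 2 f_equal; [f_equal; rewrite sin_0; ring|f_equal; ring].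
  + apply Rmult_le_pos; lra.
  + ring.
  + ring.
  + exists j; auto.
Qed.

Lemma partial_length_total : partial_length (N k) - partial_length 0 = rsum arc_length_term k.
Proof.
pose proof (cp_nb_arcs _ HG) as Hk; fold k in Hk.
destruct (orbit_in_arc 0 0) as [_ ->]; [lia|rewrite N0; split; [lia|rewrite <- N0 at 1; apply Nincr; lia]|].
unfold partial_length; rewrite arc_last; cbv zeta; unfold step_index.
rewrite N0, Nat.Div0.mod_same, be_turn; simpl; ring.
Qed.

Lemma orbit_last : orbit (N k) = (fst (orbit 0) + 2 * PI, snd (orbit 0)).
Proof.
pose proof (cp_nb_arcs _ HG) as Hk; fold k in Hk.
destruct (orbit_in_arc 0 0) as [-> _]; [lia|rewrite N0; split; [lia|rewrite <- N0 at 1; apply Nincr; lia]|].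
unfold orbit; rewrite arc_last; cbv zeta; unfold step_index.
rewrite N0, Nat.Div0.mod_same, be_turn; simpl; f_equal.
unfold k at 1; rewrite (cp_turn _ HG); ring.
Qed.

Lemma orbit_periodic : one_turn_periodic G (N k) orbit.
Proof.
pose proof (cp_nb_arcs _ HG) as Hk; fold k in Hk.
assert (Hlast : (k <= N k)%nat).
{ assert (H : forall m, (m <= k)%nat -> (m <= N m)%nat); [|auto].
  induction m as [|m IH]; intros Hm; [lia|].
  pose proof (Nincr m Hm); specialize (IH ltac:(lia)); lia. }
pose proof PI2_1 as Hpi.
split; [lia|split; [|now rewrite orbit_last]].
intros n H.
destruct (orbit_step n H) as (j & t & Hj & Hz & Ht & _ & Hphi & Hth & j' & Hj' & Hth').
pose proof (th_bound j Hj) as Hb; pose proof (th_bound j' Hj') as Hb'.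
unfold billiard_map.
destruct (orbit n) as [phi theta]; destruct (orbit (S n)) as [phi' theta'].
cbn [fst snd] in *; subst theta theta' phi'; cbv zeta.
rewrite !cis_tangent.
split; [|lra].
repeat split; try lra.
(* The two angles sum to at most 2, which is less than a full turn. *)
- intros Heq; apply (cp_simple _ HG phi (phi + th j + th j')); [lra|easy].
- now exists t.
Qed.

Lemma orbit_length : traj_length G (N k) orbit = rsum arc_length_term k.
Proof.
pose proof orbit_periodic as [Hq _].
unfold traj_length; rewrite <- partial_length_total.
replace (partial_length (N k)) with (partial_length (S (N k - 1))) by (f_equal; lia).
rewrite <- (sum_n_telescope partial_length (N k - 1)).
apply sum_n_ext_loc; intros n Hn.
(* The length closes the polygon by reducing the index, whereas the orbit goes on to the same point
   one turn later. *)
assert (Hz : z G (fst (orbit (S n mod N k)%nat)) = z G (fst (orbit (S n)))).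
{ destruct (Nat.eq_dec (S n) (N k)) as [e|e].
  - rewrite e, Nat.Div0.mod_same, orbit_last; cbn [fst]; now rewrite z_periodic.
  - now rewrite Nat.mod_small by lia. }
rewrite Hz.
destruct (orbit_step n ltac:(lia)) as (j & t & _ & Hz' & Ht & Hlen & _).
rewrite Hz', <- Hlen.
rewrite <- (Cmod_tangent t (fst (orbit n) + snd (orbit n)) Ht) at 2.
f_equal; set (w := Cmult _ _); ring.
Qed.

Lemma exists_trajectory : exists g, one_turn_periodic G (N k) g /\
  traj_length G (N k) g = rsum (fun j =>
    radius G j * (2 * (INR (N (S j)) - INR (N j)) * sin (th j) + sin (be j) - sin (be (S j)))) k.
Proof. exists orbit; split; [apply orbit_periodic|apply orbit_length]. Qed.

End Trajectory.

(** * Existence of the angles of incidence *)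

(** Seeks a fixed point of th_j = (dl_j + be_(j+1) - be_j) / (2 n_j), where be is computed from th
    by [turn]. The box is stable because every be lies in [0, M] and [M <= h]; the lower bound on
    [n j] makes the map a contraction. *)
Lemma closed_profile (k : nat) (r dl n : nat -> R) (c m M h mt Lr : R) :
  let nx j := (S j mod k)%nat in
  let box th := forall j, (j < k)%nat -> Rabs (2 * n j * th j - dl j) <= h in
  (1 < k)%nat ->
  (forall j, (j < k)%nat -> 0 < r j) ->
  (forall j, (j < k)%nat -> r j <> r (nx j)) ->
  (forall j, (j < k)%nat -> r j + r (nx j) <= Lr * Rabs (r j - r (nx j))) ->
  0 < c <= 1 -> 0 < m -> 0 < M <= 1 -> M ^ 2 <= 6 * c -> M <= h ->
  0 < mt -> 2 * mt ^ 2 <= c * m ^ 2 ->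
  (forall j, (j < k)%nat -> 0 < n j /\ 4 * Lr * M / mt <= n j) ->
  (forall th, box th -> forall j, (j < k)%nat -> m <= th j <= M) ->
  (forall th, box th -> forall j, (j < k)%nat ->
     crossable c (r j) (r (nx j)) (th j) (th (nx j))) ->
  exists th be,
    box th /\
    (forall j, (j <= k)%nat -> 0 <= be j) /\
    (forall j, (j < k)%nat -> be (S j) <= th j) /\
    be k = be 0%nat /\
    (forall j, (j < k)%nat -> 2 * n j * th j = dl j + be (S j) - be j) /\
    (forall j, (j < k)%nat ->
       (r (nx j) - r j) * cos (be (S j)) = r (nx j) * cos (th (nx j)) - r j * cos (th j)).
Proof.
intros nx box Hk Hr Hne HLr Hc Hm HM HMc HMh Hmt Hmtc Hn Hb Hcr.
set (tau := fun (th : nat -> R) i => turn (r i) (r (nx i)) (th i) (th (nx i))).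
(* [tau th i] belongs to the node that ends arc [i], so be at index [j] is [tau th (pv j)]; the
   cyclic predecessor takes the same value at 0 and [k]. *)
set (pv := fun j => ((j + k - 1) mod k)%nat).
assert (Hnx : forall j, (nx j < k)%nat) by (intros; now apply mod_lt).
assert (Hpv : forall j, (pv j < k)%nat) by (intros; now apply mod_lt).
assert (HpvS : forall j, (j < k)%nat -> pv (S j) = j).
{ intros j Hj; unfold pv; replace (S j + k - 1)%nat with (j + 1 * k)%nat by lia.
  rewrite Nat.Div0.mod_add; now apply Nat.mod_small. }
assert (Hspec : forall th, box th -> forall i, (i < k)%nat ->
  (r (nx i) - r i) * cos (tau th i) = r (nx i) * cos (th (nx i)) - r i * cos (th i) /\
  mt <= tau th i <= th i /\ tau th i <= M).
{ intros th Hth i Hi.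
  pose proof (Hb th Hth i Hi) as H1; pose proof (Hb th Hth _ (Hnx i)) as H2.
  destruct (turn_spec c (r i) (r (nx i)) (th i) (th (nx i))) as (E1 & E2 & E3 & E4);
    auto; try nra.
  specialize (E4 m ltac:(lra) ltac:(lra)); fold (tau th i) in *.
  split; [easy|split; [split; [|easy]|lra]].
  apply Rnot_lt_le; intros Hlt; assert (tau th i ^ 2 < mt ^ 2); [|lra].
  simpl; rewrite !Rmult_1_r; apply Rmult_le_0_lt_compat; lra. }
assert (Hbox : forall x : nat -> R, (forall j, (j < k)%nat ->
  (dl j - h) / (2 * n j) <= x j <= (dl j + h) / (2 * n j)) -> box x).
{ intros x Hx j Hj; specialize (Hx j Hj); destruct (Hn j Hj) as [Hn0 _].
  apply Rabs_le; destruct Hx as [H1 H2].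
  apply Rle_div_l in H1; [|lra]; apply Rle_div_r in H2; [|lra]; lra. }
set (T := fun th j => (dl j + tau th (pv (S j)) - tau th (pv j)) / (2 * n j)).
destruct (box_fixed_point k (fun j => (dl j - h) / (2 * n j)) (fun j => (dl j + h) / (2 * n j)) T)
  as [th [Hth Hfix]].
- intros j Hj; destruct (Hn j Hj).
  apply Rmult_le_compat_r; [apply Rlt_le, Rinv_0_lt_compat; lra|lra].
- intros x Hx j Hj; specialize (Hbox x Hx); destruct (Hn j Hj) as [Hn0 _].
  pose proof (Hspec x Hbox _ (Hpv (S j))) as [_ H1].
  pose proof (Hspec x Hbox _ (Hpv j)) as [_ H2].
  unfold T, Rdiv; split; (apply Rmult_le_compat_r; [apply Rlt_le, Rinv_0_lt_compat; lra|lra]).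
- intros x y d Hx Hy Hd j Hj; apply Hbox in Hx; apply Hbox in Hy.
  destruct (Hn j Hj) as [Hn0 Hn1].
  assert (Htau : forall i, (i < k)%nat ->
    Rabs (tau x i - tau y i) <= 2 * Lr * M / mt * d).
  { intros i Hi; destruct (Hspec x Hx i Hi) as (A1 & A2 & A3).
    destruct (Hspec y Hy i Hi) as (B1 & B2 & B3).
    pose proof (Hb x Hx i Hi); pose proof (Hb x Hx _ (Hnx i)).
    pose proof (Hb y Hy i Hi); pose proof (Hb y Hy _ (Hnx i)).
    unfold tau in *; apply turn_lipschitz; auto; lra. }
  pose proof (Htau _ (Hpv (S j))) as H1; pose proof (Htau _ (Hpv j)) as H2.
  assert (Hd0 : 0 <= d) by (specialize (Hd j Hj); pose proof (Rabs_pos (x j - y j)); lra).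
  unfold T.
  replace (_ - _) with ((tau x (pv (S j)) - tau y (pv (S j)) -
    (tau x (pv j) - tau y (pv j))) / (2 * n j)) by (field; lra).
  rewrite Rabs_div, (Rabs_right (2 * n j)) by lra.
  apply Rle_div_l; [lra|].
  (* Each of the two node angles contributes [2 * Lr * M / mt * d]; the lower bound on [n j] turns
     the total into [d / 2] after division by [2 * n j]. *)
  apply Rle_trans with (4 * Lr * M / mt * d).
  + apply Rle_trans with (1 := Rabs_triang _ _); rewrite Rabs_Ropp; lra.
  + replace (d / 2 * (2 * n j)) with (n j * d) by field.
    now apply Rmult_le_compat_r.
- apply Hbox in Hth.
  exists th, (fun j => tau th (pv j)).
  split; [easy|split; [|split; [|split; [|split]]]].
  + intros j _; destruct (Hspec th Hth _ (Hpv j)); lra.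
  + intros j Hj; rewrite HpvS by easy; destruct (Hspec th Hth j Hj); lra.
  + f_equal; unfold pv; replace (k + k - 1)%nat with (0 + k - 1 + 1 * k)%nat by lia.
    apply Nat.Div0.mod_add.
  + intros j Hj; destruct (Hn j Hj) as [Hn0 _].
    rewrite <- (Hfix j Hj) at 1; unfold T; field; lra.
  + intros j Hj; rewrite HpvS by easy; now destruct (Hspec th Hth j Hj).
Qed.

(** From n = Q dl l / W + O(1) and 2 n th = dl + O(1/Q), the normalised inverse angle W / (2 Q th)
    recovers [l] up to O(1/Q). Powers of [A >= 10] absorb the numerical constants. *)
Lemma angle_estimates (A Q dl l W n th : R) :
  10 <= A -> 300000 * A ^ 18 <= Q ->
  / A <= dl <= A -> / A <= l <= 3 * A -> / A <= W <= 24 * A ->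
  Rabs (n - Q * dl * l / W) <= 1 ->
  Rabs (2 * n * th - dl) <= 48 * A ^ 4 / Q ->
  Q / (48 * A ^ 3) <= n /\
  / (16 * A ^ 4 * Q) <= th <= 48 * A ^ 4 / Q /\
  Rabs (W / (2 * Q * th) - l) <= 300 * A ^ 6 / Q.
Proof.
intros HA HQ Hdl Hl HW Hn Hth.
assert (HAp : forall i, 0 < A ^ i) by (intros; apply pow_lt; lra).
assert (HA1 : forall i, 1 <= A ^ i) by (intros; apply pow_R1_Rle; lra).
assert (Hia : / A * A = 1) by (field; lra).
assert (Hia0 : 0 < / A) by (apply Rinv_0_lt_compat; lra).
pose proof (HA1 18%nat) as H18.
assert (HQ0 : 0 < Q) by lra.
assert (HQ3 : 48 * A ^ 3 <= Q).
{ assert (A ^ 18 = A ^ 3 * A ^ 15) by ring; pose proof (HA1 15%nat); pose proof (HAp 3%nat); nra. }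
assert (HQ5 : 96 * A ^ 5 <= Q).
{ assert (A ^ 18 = A ^ 5 * A ^ 13) by ring; pose proof (HA1 13%nat); pose proof (HAp 5%nat); nra. }
set (h := 48 * A ^ 4 / Q) in *.
assert (Hh : h * A <= / 2).
{ unfold h; replace (48 * A ^ 4 / Q * A) with (48 * A ^ 5 / Q) by (field; lra).
  apply Rle_div_l; lra. }
assert (HW0 : 0 < W) by lra.
apply Rabs_le_between in Hn; destruct Hn as [Hn1 Hn2].
assert (HnW1 : Q * dl * l - W <= n * W).
{ replace (Q * dl * l) with (Q * dl * l / W * W) by (field; lra); nra. }
assert (HnW2 : n * W <= Q * dl * l + W).
{ replace (Q * dl * l) with (Q * dl * l / W * W) by (field; lra); nra. }
assert (Hdla : 1 <= dl * A) by nra.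
assert (Hla : 1 <= l * A) by nra.
assert (HWa : 1 <= W * A) by nra.
assert (Hdl0 : 0 < dl) by lra.
assert (Hl0 : 0 < l) by lra.
assert (Hdll : 1 <= dl * l * A ^ 2).
{ replace (dl * l * A ^ 2) with ((dl * A) * (l * A)) by ring; nra. }
assert (HWA2 : W * A ^ 2 <= 24 * A ^ 3).
{ replace (24 * A ^ 3) with (24 * A * A ^ 2) by ring.
  apply Rmult_le_compat_r; [apply Rlt_le, HAp|lra]. }
assert (HnWA : Q / 2 <= n * W * A ^ 2).
{ assert (Q * (dl * l * A ^ 2) - W * A ^ 2 <= n * W * A ^ 2).
  { replace (Q * (dl * l * A ^ 2) - W * A ^ 2) with ((Q * dl * l - W) * A ^ 2) by ring.
    apply Rmult_le_compat_r; [apply Rlt_le, HAp|easy]. }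
  assert (Q * 1 <= Q * (dl * l * A ^ 2)) by (apply Rmult_le_compat_l; lra).
  lra. }
assert (Hn0 : 0 < n).
{ destruct (Rlt_dec 0 n) as [|c]; [easy|exfalso].
  assert (0 <= - n * (W * A ^ 2)).
  { apply Rmult_le_pos; [lra|]; apply Rmult_le_pos; [lra|apply Rlt_le, HAp]. }
  nra. }
assert (Hnlo : Q / (48 * A ^ 3) <= n).
{ apply Rle_div_l; [pose proof (HAp 3%nat); lra|].
  assert (n * (W * A ^ 2) <= n * (24 * A ^ 3)) by (apply Rmult_le_compat_l; lra).
  lra. }
assert (Hnhi : n <= 4 * A ^ 3 * Q).
{ assert (Hdl2 : dl * l <= 3 * A ^ 2).
  { replace (3 * A ^ 2) with (A * (3 * A)) by ring; apply Rmult_le_compat; lra. }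
  apply Rmult_le_reg_r with W; [easy|].
  assert (Q * (dl * l) <= Q * (3 * A ^ 2)) by (apply Rmult_le_compat_l; lra).
  assert (3 * A ^ 2 * Q * 1 <= 3 * A ^ 2 * Q * (W * A)).
  { apply Rmult_le_compat_l; [pose proof (HAp 2%nat); nra|easy]. }
  assert (1 * W <= A ^ 3 * Q * W).
  { apply Rmult_le_compat_r; [lra|]; pose proof (HA1 3%nat); nra. }
  replace (4 * A ^ 3 * Q * W) with (3 * A ^ 2 * Q * (W * A) + A ^ 3 * Q * W) by ring.
  nra. }
assert (Hh0 : 0 < h) by (apply Rdiv_lt_0_compat; [pose proof (HAp 4%nat); lra|easy]).
assert (Hhd : h <= dl / 2) by nra.
apply Rabs_le_between in Hth; destruct Hth as [Hth1 Hth2].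
assert (Hth0 : 0 < th).
{ destruct (Rlt_dec 0 th) as [|c]; [easy|exfalso].
  assert (0 <= n * - th) by (apply Rmult_le_pos; lra); lra. }
assert (HDa : / 2 <= 2 * n * th * A) by nra.
split; [easy|split; [split|]].
- assert (Hp : 0 < 16 * A ^ 4 * Q) by (pose proof (HAp 4%nat); nra).
  apply Rmult_le_reg_r with (16 * A ^ 4 * Q); [easy|].
  rewrite Rinv_l by lra.
  assert (n * (th * A) <= 4 * A ^ 3 * Q * (th * A)) by (apply Rmult_le_compat_r; nra).
  replace (th * (16 * A ^ 4 * Q)) with (4 * (4 * A ^ 3 * Q * (th * A))) by ring.
  lra.
- apply Rle_div_r; [easy|].
  assert (Q <= n * (48 * A ^ 3)) by (apply Rle_div_l in Hnlo; [lra|pose proof (HAp 3%nat); lra]).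
  assert (th * Q <= th * (n * (48 * A ^ 3))) by (apply Rmult_le_compat_l; lra).
  assert (H24 : 2 * n * th * (24 * A ^ 3) <= 2 * A * (24 * A ^ 3)).
  { apply Rmult_le_compat_r; [pose proof (HAp 3%nat); lra|lra]. }
  replace (48 * A ^ 4) with (2 * A * (24 * A ^ 3)) by ring; lra.
- set (D := 2 * n * th) in *.
  assert (HD : 0 < D) by (unfold D; nra).
  (* The first part of the numerator is the rounding error of [n], the second the deviation of [D]
     from [dl] allowed by the box. *)
  replace (W / (2 * Q * th) - l) with ((n * W - Q * dl * l + Q * l * (dl - D)) / (Q * D))
    by (unfold D; field; lra).
  rewrite Rabs_div, (Rabs_right (Q * D)) by nra.
  apply Rle_div_l; [nra|].
  assert (Hnum : Rabs (n * W - Q * dl * l + Q * l * (dl - D)) <= 24 * A + 144 * A ^ 5).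
  { apply Rle_trans with (1 := Rabs_triang _ _).
    apply Rplus_le_compat; [apply Rabs_le; lra|].
    rewrite Rabs_mult, (Rabs_right (Q * l)) by nra.
    apply Rle_trans with (Q * (3 * A) * h).
    - apply Rmult_le_compat; [nra|apply Rabs_pos|apply Rmult_le_compat_l; lra|].
      apply Rabs_le; lra.
    - unfold h; apply Req_le; field; lra. }
  apply Rle_trans with (1 := Hnum).
  replace (300 * A ^ 6 / Q * (Q * D)) with (300 * A ^ 5 * (D * A)) by (field; lra).
  assert (300 * A ^ 5 * / 2 <= 300 * A ^ 5 * (D * A)).
  { apply Rmult_le_compat_l; [pose proof (HAp 5%nat); lra|easy]. }
  assert (24 * A <= 6 * A ^ 5); [|lra].
  replace (A ^ 5) with (A * A ^ 4) by ring; pose proof (HA1 4%nat).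
  assert (10000 <= A ^ 4); [|nra].
  replace 10000 with (10 ^ 4) by ring; apply pow_incr; lra.
Qed.

(* Since [p^2 / (u + v p)^2] increases with [p], the ratio of the two angles
   stays below [sqrt (p^3 / p'^3)]; the slack [v >= K / Q] makes them
   strictly monotone in spite of the errors on [mu] and [mu']. *)
Lemma crossable_profile (A Q u v p p' mu mu' w : R) :
  10 <= A -> 300000 * A ^ 18 <= Q ->
  / A <= p <= A -> / A <= p' <= A -> / A <= p - p' ->
  0 <= u -> 600 * A ^ 7 / Q <= v -> / A <= u + v * p' -> 0 < w ->
  Rabs (mu - (u + v * p)) <= 300 * A ^ 6 / Q ->
  Rabs (mu' - (u + v * p')) <= 300 * A ^ 6 / Q ->
  0 < mu' /\ w / mu <= w / mu' /\
  p' ^ 3 * (w / mu') ^ 2 <= (1 - / (2 * A ^ 2)) * (p ^ 3 * (w / mu) ^ 2).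
Proof.
intros HA HQ Hp Hp' Hpp Hu Hv Hl Hw Hmu Hmu'.
assert (HAp : forall i, 0 < A ^ i) by (intros; apply pow_lt; lra).
assert (HA1 : forall i, 1 <= A ^ i) by (intros; apply pow_R1_Rle; lra).
assert (Hia : / A * A = 1) by (field; lra).
assert (Hia0 : 0 < / A) by (apply Rinv_0_lt_compat; lra).
assert (HQ0 : 0 < Q) by (pose proof (HA1 18%nat); lra).
set (eta := 300 * A ^ 6 / Q) in *.
assert (Heta0 : 0 < eta) by (apply Rdiv_lt_0_compat; [pose proof (HAp 6%nat); lra|easy]).
assert (Hv' : 2 * A * eta <= v) by (unfold eta; unfold Rdiv in *; lra).
assert (Heta : 24 * A ^ 3 * eta <= 1).
{ unfold eta; replace (24 * A ^ 3 * (300 * A ^ 6 / Q)) with (7200 * A ^ 9 / Q) by (field; lra).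
  apply Rle_div_l; [easy|].
  assert (A ^ 18 = A ^ 9 * A ^ 9) by ring; pose proof (HA1 9%nat); nra. }
assert (HA3 : A <= A ^ 3) by (replace (A ^ 3) with (A * A ^ 2) by ring; pose proof (HA1 2%nat); nra).
assert (HetaA : 24 * A * eta <= 1) by nra.
apply Rabs_le_between in Hmu; apply Rabs_le_between in Hmu'.
assert (Hmu'A : / 2 <= mu' * A) by nra.
assert (Hmu'0 : 0 < mu') by nra.
(* The slope [v] separates the two exact values by at least the sum of the errors on [mu] and [mu'],
   so their order is preserved. *)
assert (Hvp : 2 * eta <= v * (p - p')).
{ apply Rle_trans with (v * / A); [|apply Rmult_le_compat_l; nra].
  replace (2 * eta) with (2 * A * eta * / A) by (field; lra).
  apply Rmult_le_compat_r; lra. }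
assert (Hord : mu' <= mu) by lra.
split; [easy|split].
- apply Rmult_le_compat_l; [lra|]; apply Rinv_le_contravar; lra.
- set (ka := 4 * A * eta).
  assert (Hka : 6 * A ^ 2 * ka <= 1) by (unfold ka; lra).
  assert (Hka0 : 0 < ka) by (unfold ka; nra).
  assert (Hka1 : ka <= 1) by (pose proof (HA1 2%nat); nra).
  assert (H1 : p' * mu <= p * mu' * (1 + ka)).
  { assert (p' * mu <= p' * (u + v * p + eta)) by (apply Rmult_le_compat_l; lra).
    assert (p * (u + v * p' - eta) <= p * mu') by (apply Rmult_le_compat_l; lra).
    assert (p' * u <= p * u) by (apply Rmult_le_compat_r; lra).
    assert (2 * p * eta <= p * mu' * ka).
    { unfold ka; replace (p * mu' * (4 * A * eta)) with (4 * p * eta * (mu' * A)) by ring.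
      replace (2 * p * eta) with (4 * p * eta * / 2) by field.
      apply Rmult_le_compat_l; nra. }
    nra. }
  assert (H2 : (p' * mu) ^ 2 <= (p * mu') ^ 2 * (1 + 3 * ka)).
  { apply Rle_trans with ((p * mu' * (1 + ka)) ^ 2).
    - apply pow_incr; split; [nra|easy].
    - replace ((p * mu' * (1 + ka)) ^ 2) with ((p * mu') ^ 2 * (1 + ka) ^ 2) by ring.
      apply Rmult_le_compat_l; [apply pow2_ge_0|nra]. }
  (* The gap gives p' <= (1 - 1/A^2) p; half of this margin pays for the errors and the other half
     is kept. *)
  assert (H3 : p' * (1 + 3 * ka) <= (1 - / (2 * A ^ 2)) * p).
  { set (b := / (2 * A ^ 2)).
    assert (Hb : b * A ^ 2 = / 2) by (unfold b; field; lra).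
    assert (Hb0 : 0 < b) by (apply Rinv_0_lt_compat; pose proof (HAp 2%nat); lra).
    assert (Hkb : 3 * ka <= b).
    { apply Rmult_le_reg_r with (A ^ 2); [apply HAp|]; lra. }
    assert (Hpb : 2 * b * p <= / A).
    { replace (/ A) with (2 * b * A) by (unfold b; field; lra).
      apply Rmult_le_compat_l; lra. }
    assert (p' * (3 * ka) <= p * b) by (apply Rmult_le_compat; lra).
    lra. }
  replace (p' ^ 3 * (w / mu') ^ 2) with (w ^ 2 / (mu * mu') ^ 2 * (p' * (p' * mu) ^ 2)) by (field; lra).
  replace ((1 - / (2 * A ^ 2)) * (p ^ 3 * (w / mu) ^ 2)) with
    (w ^ 2 / (mu * mu') ^ 2 * ((1 - / (2 * A ^ 2)) * p * (p * mu') ^ 2)) by (field; lra).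
  apply Rmult_le_compat_l.
  + apply Rmult_le_pos; [apply pow2_ge_0|apply Rlt_le, Rinv_0_lt_compat, pow_lt; nra].
  + apply Rle_trans with (p' * ((p * mu') ^ 2 * (1 + 3 * ka))).
    * apply Rmult_le_compat_l; lra.
    * replace (p' * ((p * mu') ^ 2 * (1 + 3 * ka))) with (p' * (1 + 3 * ka) * (p * mu') ^ 2) by ring.
      apply Rmult_le_compat_r; [apply pow2_ge_0|easy].
Qed.

(** Provides the value [A ^ 6] of the constant [Lr] from the gap between the cube roots of the
    radii. *)
Lemma cube_ratio (A p p' : R) : 10 <= A -> / A <= p <= A -> / A <= p' <= A ->
  / A <= p - p' -> p ^ 3 + p' ^ 3 <= A ^ 6 * (p ^ 3 - p' ^ 3).
Proof.
intros HA Hp Hp' Hpp.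
assert (Hia0 : 0 < / A) by (apply Rinv_0_lt_compat; lra).
assert (H2 : p ^ 3 <= A ^ 3) by (apply pow_incr; lra).
assert (H3 : p' ^ 3 <= A ^ 3) by (apply pow_incr; lra).
assert (H6 : 0 < A ^ 6) by (apply pow_lt; lra).
apply Rle_trans with (A ^ 6 * (2 * (/ A) ^ 3)).
- replace (A ^ 6 * (2 * (/ A) ^ 3)) with (2 * A ^ 3) by (field; lra); lra.
- apply Rmult_le_compat_l; [lra|].
  assert (E : p ^ 3 - p' ^ 3 = (p - p') * (p ^ 2 + p * p' + p' ^ 2)) by ring.
  assert ((/ A) ^ 2 <= p ^ 2) by (apply pow_incr; lra).
  assert ((/ A) ^ 2 <= p' ^ 2) by (apply pow_incr; lra).
  assert (0 <= p * p') by (apply Rmult_le_pos; lra).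
  rewrite E; replace (2 * (/ A) ^ 3) with (/ A * (2 * (/ A) ^ 2)) by ring.
  apply Rmult_le_compat; [lra|pose proof (pow2_ge_0 (/ A)); lra|lra|lra].
Qed.

(* [A] bounds the geometric data and [Q] is the number of impacts; the shift
   [600 * A ^ 7 / Q] outweighs the rounding of the [n j]. *)
Lemma profile_exists (k : nat) (p dl n : nat -> R) (A Q t : R) :
  let nx j := (S j mod k)%nat in
  let l j := (1 - t) + (t + 600 * A ^ 7 / Q) * p j in
  let W := rsum (fun j => dl j * l j) k in
  10 <= A -> 300000 * A ^ 18 <= Q -> 0 <= t <= 1 -> (1 < k)%nat ->
  (forall j, (j < k)%nat -> / A <= dl j <= A) ->
  (forall j, (j < k)%nat -> / A <= p j <= A) ->
  (forall j, (j < k)%nat -> / A <= Rabs (p j - p (nx j))) ->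
  rsum dl k = 2 * PI ->
  (forall j, (j < k)%nat -> Rabs (n j - Q * dl j * l j / W) <= 1) ->
  exists th be,
    (forall j, (j < k)%nat -> 0 < th j <= 48 * A ^ 4 / Q) /\ 48 * A ^ 4 / Q <= 1 /\
    (forall j, (j <= k)%nat -> 0 <= be j) /\
    (forall j, (j < k)%nat -> be (S j) <= th j) /\
    be k = be 0%nat /\
    (forall j, (j < k)%nat -> 2 * n j * th j = dl j + be (S j) - be j) /\
    (forall j, (j < k)%nat ->
       (p (nx j) ^ 3 - p j ^ 3) * cos (be (S j)) =
       p (nx j) ^ 3 * cos (th (nx j)) - p j ^ 3 * cos (th j)) /\
    (forall j, (j < k)%nat -> 1 <= n j) /\
    (forall j, (j < k)%nat -> Rabs (W / (2 * Q * th j) - l j) <= 300 * A ^ 6 / Q).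
Proof.
intros nx l W HA HQ Ht Hk Hdl Hp Hgap Hsum Hn.
assert (HAp : forall i, 0 < A ^ i) by (intros; apply pow_lt; lra).
assert (HA1 : forall i, 1 <= A ^ i) by (intros; apply pow_R1_Rle; lra).
assert (Hia : / A * A = 1) by (field; lra).
assert (Hia0 : 0 < / A) by (apply Rinv_0_lt_compat; lra).
assert (Hia1 : / A <= 1) by nra.
assert (HQ0 : 0 < Q) by (pose proof (HA1 18%nat); lra).
assert (Hnx : forall j, (nx j < k)%nat) by (intros; now apply mod_lt).
assert (HKe : 0 < 600 * A ^ 7 / Q <= 1).
{ split; [apply Rdiv_lt_0_compat; [pose proof (HAp 7%nat); lra|easy]|].
  apply Rle_div_l; [easy|].
  assert (A ^ 18 = A ^ 7 * A ^ 11) by ring; pose proof (HA1 11%nat); pose proof (HAp 7%nat); nra. }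
set (v := t + 600 * A ^ 7 / Q) in *.
assert (Hl : forall j, (j < k)%nat -> / A <= l j <= 3 * A).
{ intros j Hj; specialize (Hp j Hj); unfold l; fold v; split.
  - assert (t * / A <= v * p j) by (apply Rmult_le_compat; unfold v; lra); nra.
  - assert (v * p j <= 2 * A) by (apply Rmult_le_compat; unfold v; lra); lra. }
pose proof PI2_1 as Hpi1; pose proof PI_4 as Hpi2.
assert (HW : / A <= W <= 24 * A).
{ unfold W; split.
  - apply Rle_trans with (rsum (fun j => / A * dl j) k).
    + rewrite rsum_scal, Hsum; nra.
    + apply rsum_le; intros j Hj; rewrite Rmult_comm; apply Rmult_le_compat_l.
      * specialize (Hdl j Hj); lra.
      * now apply Hl.
  - apply Rle_trans with (rsum (fun j => 3 * A * dl j) k).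
    + apply rsum_le; intros j Hj; rewrite Rmult_comm; apply Rmult_le_compat_r.
      * specialize (Hdl j Hj); lra.
      * now apply Hl.
    + rewrite rsum_scal, Hsum; nra. }
set (M := 48 * A ^ 4 / Q).
assert (HM1 : 48 * A ^ 5 / Q <= 1).
{ apply Rle_div_l; [easy|].
  assert (A ^ 18 = A ^ 5 * A ^ 13) by ring; pose proof (HA1 13%nat); pose proof (HAp 5%nat); nra. }
assert (HM0 : 0 < M) by (apply Rdiv_lt_0_compat; [pose proof (HAp 4%nat); lra|easy]).
assert (HMA : M * A <= 1).
{ unfold M; replace (48 * A ^ 4 / Q * A) with (48 * A ^ 5 / Q) by (field; lra); easy. }
assert (HM : M <= 1) by nra.
assert (Hest : forall th j, (j < k)%nat -> Rabs (2 * n j * th - dl j) <= M ->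
  Q / (48 * A ^ 3) <= n j /\ / (16 * A ^ 4 * Q) <= th <= M /\
  Rabs (W / (2 * Q * th) - l j) <= 300 * A ^ 6 / Q).
{ intros th j Hj H; apply (angle_estimates A Q (dl j)); auto. }
assert (Hnlo : forall j, (j < k)%nat -> Q / (48 * A ^ 3) <= n j).
(* [Hest] bounds [n j] from below given any angle in the box, such as its centre [dl j / (2 * n j)];
   the value 0 is first excluded, since Q dl l / W exceeds 1. *)
{ intros j Hj; destruct (Req_dec (n j) 0) as [e|e].
  - exfalso; specialize (Hn j Hj); rewrite e in Hn.
    specialize (Hdl j Hj); specialize (Hl j Hj).
    assert (H1 : Q * dl j * l j / W <= 1).
    { apply Rabs_le_between in Hn; lra. }
    apply Rle_div_l in H1; [|lra].
    assert (HdA : 1 <= dl j * A) by nra. assert (HlA : 1 <= l j * A) by nra.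
    assert (1 * 1 <= (dl j * A) * (l j * A)) by (apply Rmult_le_compat; lra).
    assert (Q * 1 <= Q * ((dl j * A) * (l j * A))) by (apply Rmult_le_compat_l; lra).
    assert (Q * dl j * l j * A ^ 2 <= 1 * W * A ^ 2)
      by (apply Rmult_le_compat_r; [apply Rlt_le, HAp|easy]).
    assert (W * A ^ 2 <= 24 * A * A ^ 2) by (apply Rmult_le_compat_r; [apply Rlt_le, HAp|lra]).
    assert (A ^ 18 = A ^ 3 * A ^ 15) by ring; pose proof (HA1 15%nat); pose proof (HAp 3%nat).
    nra.
  - destruct (Hest (dl j / (2 * n j)) j Hj) as [H _]; [|easy].
    replace (2 * n j * (dl j / (2 * n j)) - dl j) with 0 by (field; lra).
    rewrite Rabs_R0; lra. }
assert (Hi2 : 0 < / (2 * A ^ 2) <= 1).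
{ split; [apply Rinv_0_lt_compat; pose proof (HAp 2%nat); lra|].
  rewrite <- Rinv_1; apply Rinv_le_contravar; [lra|pose proof (HA1 2%nat); lra]. }
assert (Hnbig : forall j, (j < k)%nat -> 0 < n j /\ 1 <= n j /\
  4 * A ^ 6 * M / (/ (32 * A ^ 5 * Q)) <= n j).
{ intros j Hj; specialize (Hnlo j Hj).
  (* 6144 = 4 * 48 * 32 comes from [4 * Lr * M / mt]; as 6144 * 48 = 294912, it dictates the
     threshold [300000 * A ^ 18] on [Q]. *)
  assert (H0 : 6144 * A ^ 15 <= n j).
  { apply Rle_trans with (2 := Hnlo); apply (Rle_div_r (6144 * A ^ 15) Q (48 * A ^ 3)); [pose proof (HAp 3%nat); lra|].
    replace (6144 * A ^ 15 * (48 * A ^ 3)) with (294912 * A ^ 18) by ring.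
    pose proof (HAp 18%nat); lra. }
  pose proof (HA1 15%nat).
  split; [lra|split; [lra|]].
  unfold M; replace (4 * A ^ 6 * (48 * A ^ 4 / Q) / / (32 * A ^ 5 * Q)) with (6144 * A ^ 15)
   by (field; repeat split; lra).
  easy. }
(* The margin is that of [crossable_profile], the bounds on the angles those of [angle_estimates],
   and [mt] makes [2 * mt ^ 2 <= c * m ^ 2] an equality. *)
destruct (closed_profile k (fun j => p j ^ 3) dl n (/ (2 * A ^ 2)) (/ (16 * A ^ 4 * Q)) M M
   (/ (32 * A ^ 5 * Q)) (A ^ 6)) as (th & be & H1 & H2 & H3 & H4 & H5 & H6); auto.
- intros j Hj; apply pow_lt; specialize (Hp j Hj); lra.
- intros j Hj; specialize (Hgap j Hj); pose proof (Hp j Hj) as Ha; pose proof (Hp _ (Hnx j)) as Hb.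
  fold (nx j).
  destruct (Rle_dec (p (nx j)) (p j)) as [c|c].
  + rewrite Rabs_right in Hgap by lra.
    pose proof (cube_ratio A (p j) (p (nx j)) HA Ha Hb Hgap).
    assert (0 < p j ^ 3) by (apply pow_lt; lra); assert (0 < p (nx j) ^ 3) by (apply pow_lt; lra).
    intros e; rewrite e in *; lra.
  + rewrite Rabs_left in Hgap by lra.
    pose proof (cube_ratio A (p (nx j)) (p j) HA Hb Ha ltac:(lra)).
    assert (0 < p j ^ 3) by (apply pow_lt; lra); assert (0 < p (nx j) ^ 3) by (apply pow_lt; lra).
    intros e; rewrite e in *; lra.
- intros j Hj; specialize (Hgap j Hj); pose proof (Hp j Hj) as Ha; pose proof (Hp _ (Hnx j)) as Hb.
  fold (nx j).
  assert (Habs : forall x, A ^ 6 * x <= A ^ 6 * Rabs x).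
  { intros x; apply Rmult_le_compat_l; [apply Rlt_le, HAp|apply Rle_abs]. }
  destruct (Rle_dec (p (nx j)) (p j)) as [c|c].
  + rewrite Rabs_right in Hgap by lra.
    pose proof (cube_ratio A (p j) (p (nx j)) HA Ha Hb Hgap).
    specialize (Habs (p j ^ 3 - p (nx j) ^ 3)); lra.
  + rewrite Rabs_left in Hgap by lra.
    pose proof (cube_ratio A (p (nx j)) (p j) HA Hb Ha ltac:(lra)).
    rewrite Rabs_minus_sym; specialize (Habs (p (nx j) ^ 3 - p j ^ 3)); lra.
- apply Rinv_0_lt_compat; pose proof (HAp 4%nat); nra.
- apply Rmult_le_reg_r with (2 * A ^ 2); [pose proof (HAp 2%nat); lra|].
  replace (6 * / (2 * A ^ 2) * (2 * A ^ 2)) with 6 by (field; lra).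
  replace (M ^ 2 * (2 * A ^ 2)) with (2 * (M * A) ^ 2) by ring.
  assert ((M * A) ^ 2 <= 1 ^ 2) by (apply pow_incr; nra); lra.
- lra.
- apply Rinv_0_lt_compat; pose proof (HAp 5%nat); nra.
- apply Req_le; field; lra.
- intros j Hj; destruct (Hnbig j Hj) as (N1 & _ & N2); auto.
- intros th Hth j Hj; now apply (Hest (th j) j Hj), Hth.
- intros th Hth j Hj; fold (nx j).
  destruct (Hest (th j) j Hj (Hth j Hj)) as (_ & T1 & T2).
  destruct (Hest (th (nx j)) (nx j) (Hnx j) (Hth _ (Hnx j))) as (_ & T1' & T2').
  assert (Hlo : 0 < / (16 * A ^ 4 * Q)) by (apply Rinv_0_lt_compat; pose proof (HAp 4%nat); nra).
  (* Writes the angles as quotients w / mu, the form used by [crossable_profile]. *)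
  assert (E : forall th0, 0 < th0 -> W / (2 * Q) / (W / (2 * Q * th0)) = th0).
  { intros th0 H0; field; lra. }
  assert (Hw : 0 < W / (2 * Q)) by (apply Rdiv_lt_0_compat; lra).
  specialize (Hgap j Hj); pose proof (Hp j Hj) as Ha; pose proof (Hp _ (Hnx j)) as Hb.
  split; [lra|split; [lra|]].
  destruct (Rle_dec (p (nx j)) (p j)) as [c|c].
  + rewrite Rabs_right in Hgap by lra; left.
    destruct (crossable_profile A Q (1 - t) v (p j) (p (nx j)) (W / (2 * Q * th j))
      (W / (2 * Q * th (nx j))) (W / (2 * Q))) as (_ & C1 & C2); auto; try (unfold v; lra).
    { now apply Hl. }
    rewrite !E in C1, C2 by lra.
    split; [|easy].
    pose proof (cube_ratio A (p j) (p (nx j)) HA Ha Hb Hgap) as Hcr.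
    assert (0 < p j ^ 3) by (apply pow_lt; lra); assert (0 < p (nx j) ^ 3) by (apply pow_lt; lra).
    pose proof (HAp 6%nat); nra.
  + rewrite Rabs_left in Hgap by lra; right.
    destruct (crossable_profile A Q (1 - t) v (p (nx j)) (p j) (W / (2 * Q * th (nx j)))
      (W / (2 * Q * th j)) (W / (2 * Q))) as (_ & C1 & C2); auto; try (unfold v; lra).
    { now apply Hl. }
    rewrite !E in C1, C2 by lra.
    split; [|easy].
    pose proof (cube_ratio A (p (nx j)) (p j) HA Hb Ha ltac:(lra)) as Hcr.
    assert (0 < p j ^ 3) by (apply pow_lt; lra); assert (0 < p (nx j) ^ 3) by (apply pow_lt; lra).
    pose proof (HAp 6%nat); nra.
- exists th, be; fold M; repeat split; auto.
  + destruct (Hest (th j) j H (H1 j H)) as (_ & T1 & _).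
    assert (0 < / (16 * A ^ 4 * Q)) by (apply Rinv_0_lt_compat; pose proof (HAp 4%nat); nra); lra.
  + now apply (Hest (th j) j H), H1.
  + intros j Hj; now apply (Hnbig j Hj).
  + intros j Hj; now apply (Hest (th j) j Hj), H1.
Qed.

(** * Asymptotics of the length *)

(** Convergence with error O(1/q), stable under the operations below; applied to q^2 (L - |Gamma|),
    it is the expansion to be proved. *)
Definition approx (f : nat -> R) (l : R) : Prop := bigO_inv_pow 1 (fun q => f q - l).

Lemma approx_iff (f : nat -> R) (l : R) : approx f l <->
  exists M, 0 <= M /\ eventually (fun q => (1 <= q)%nat /\ Rabs (f q - l) <= M / INR q).
Proof.
split.
- intros [M [N HN]]; exists (Rabs M); split; [apply Rabs_pos|].
  exists (N + 1)%nat; intros q Hq; split; [lia|].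
  apply Rle_trans with (1 := HN q ltac:(lia)); rewrite pow_1.
  apply Rmult_le_compat_r; [|apply Rle_abs].
  apply Rlt_le, Rinv_0_lt_compat, lt_0_INR; lia.
- intros [M [_ [N HN]]]; exists M, N; intros q Hq; rewrite pow_1; now apply HN.
Qed.

Lemma approx_ext (f g : nat -> R) (l : R) :
  eventually (fun q => f q = g q) -> approx f l -> approx g l.
Proof.
intros [N1 H1] [M [N2 H2]]; exists M, (N1 + N2)%nat; intros q Hq.
rewrite <- H1 by lia; apply H2; lia.
Qed.

Lemma approx_const (l : R) : approx (fun _ => l) l.
Proof.
exists 0, 1%nat; intros q Hq; rewrite Rminus_diag, Rabs_R0; unfold Rdiv; lra.
Qed.

Lemma approx_plus (f g : nat -> R) (a b : R) :
  approx f a -> approx g b -> approx (fun q => f q + g q) (a + b).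
Proof.
intros [M [N1 H1]] [M' [N2 H2]]; exists (M + M'), (N1 + N2)%nat; intros q Hq.
replace (f q + g q - (a + b)) with ((f q - a) + (g q - b)) by ring.
apply Rle_trans with (1 := Rabs_triang _ _).
unfold Rdiv; rewrite Rmult_plus_distr_r; apply Rplus_le_compat; [apply H1|apply H2]; lia.
Qed.

Lemma approx_mult (f g : nat -> R) (a b : R) :
  approx f a -> approx g b -> approx (fun q => f q * g q) (a * b).
Proof.
rewrite !approx_iff.
intros (M & HM & N1 & H1) (M' & HM' & N2 & H2).
exists (M * (Rabs b + M') + Rabs a * M'); split.
- pose proof (Rabs_pos a); pose proof (Rabs_pos b); nra.
- exists (N1 + N2)%nat; intros q Hq.
  destruct (H1 q) as [H0 H1']; [lia|]; destruct (H2 q) as [_ H2']; [lia|].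
  split; [easy|].
  assert (Hq1 : 1 <= INR q) by now apply (le_INR 1).
  replace (f q * g q - a * b) with ((f q - a) * g q + a * (g q - b)) by ring.
  apply Rle_trans with (1 := Rabs_triang _ _); rewrite !Rabs_mult.
  unfold Rdiv; rewrite Rmult_plus_distr_r; apply Rplus_le_compat.
  + replace (M * (Rabs b + M') * / INR q) with (M / INR q * (Rabs b + M')) by (field; lra).
    apply Rmult_le_compat; [apply Rabs_pos|apply Rabs_pos|easy|].
    replace (g q) with (b + (g q - b)) by ring.
    apply Rle_trans with (1 := Rabs_triang _ _); apply Rplus_le_compat_l.
    apply Rle_trans with (1 := H2'); apply Rle_div_l; nra.
  + rewrite Rmult_assoc; apply Rmult_le_compat_l; [apply Rabs_pos|easy].
Qed.

Lemma approx_inv (f : nat -> R) (a : R) : 0 < a -> approx f a -> approx (fun q => / f q) (/ a).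
Proof.
intros Ha; rewrite !approx_iff.
intros (M & HM & N & H).
exists (2 * M / a ^ 2); split.
- apply Rmult_le_pos; [lra|apply Rlt_le, Rinv_0_lt_compat, pow_lt; lra].
- destruct (INR_unbounded (2 * M / a)) as [N' HN'].
  exists (N + N')%nat; intros q Hq; destruct (H q) as [H0 H1]; [lia|].
  split; [easy|].
  assert (Hq1 : 1 <= INR q) by now apply (le_INR 1).
  assert (HN'q : INR N' <= INR q) by (apply le_INR; lia).
  assert (Hs : M / INR q <= a / 2).
  { apply Rle_div_l; [lra|].
    assert (2 * M / a < INR q) by lra.
    apply Rlt_div_l in H2; lra. }
  assert (Hf : a / 2 <= f q) by (apply Rabs_le_between in H1; lra).
  replace (/ f q - / a) with ((a - f q) / (f q * a)) by (field; lra).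
  rewrite Rabs_div by nra.
  rewrite Rabs_minus_sym, (Rabs_right (f q * a)) by nra.
  apply Rle_div_l; [nra|].
  apply Rle_trans with (1 := H1).
  replace (2 * M / a ^ 2 / INR q * (f q * a)) with (M / INR q * (2 * f q / a)) by (field; lra).
  rewrite <- (Rmult_1_r (M / INR q)) at 1.
  apply Rmult_le_compat_l.
  + apply Rmult_le_pos; [easy|apply Rlt_le, Rinv_0_lt_compat; lra].
  + apply (Rle_div_r 1 (2 * f q) a); lra.
Qed.

Lemma approx_scaled (M : R) (f : nat -> R) :
  eventually (fun q => Rabs (f q) <= M / INR q ^ 3) -> approx (fun q => INR q ^ 2 * f q) 0.
Proof.
intros [N HN]; exists M, (N + 1)%nat; intros q Hq; rewrite Rminus_0_r, Rabs_mult.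
assert (Hq0 : 0 < INR q) by (apply lt_0_INR; lia).
rewrite (Rabs_right (INR q ^ 2)) by (apply Rle_ge, pow_le; lra).
replace (M / INR q ^ 1) with (INR q ^ 2 * (M / INR q ^ 3)) by (field; lra).
apply Rmult_le_compat_l; [apply pow_le; lra|apply HN; lia].
Qed.

Lemma approx_rsum (f : nat -> nat -> R) (l : nat -> R) (k : nat) :
  (forall j, (j < k)%nat -> approx (fun q => f q j) (l j)) ->
  approx (fun q => rsum (f q) k) (rsum l k).
Proof.
induction k as [|k IH]; intros H; simpl; [apply approx_const|].
apply approx_plus; [apply IH; intros; apply H; lia|apply H; lia].
Qed.

(** * Taylor remainders, rounding and interleaving *)

(** One factor [th] of the remainder is kept next to [2 * n], because the product [2 * n * th] stays
    bounded while [n] does not. *)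
Lemma sin_defect_arc (n th C Q : R) : 0 <= th <= C / Q -> C / Q <= 1 -> 1 <= Q -> 0 <= n ->
  Rabs (2 * n * (sin th - th) + 2 * n * th * th ^ 2 / 6) <= 2 * n * th * C ^ 3 / Q ^ 3.
Proof.
intros Hth HC HQ Hn.
destruct (sin_bounds th ltac:(lra)) as [H1 H2].
replace (2 * n * (sin th - th) + 2 * n * th * th ^ 2 / 6) with
  (2 * n * (sin th - (th - th ^ 3 / 6))) by field.
rewrite Rabs_right by (apply Rle_ge, Rmult_le_pos; lra).
replace (2 * n * th * C ^ 3 / Q ^ 3) with (2 * n * (th * (C / Q) ^ 3)) by (field; lra).
apply Rmult_le_compat_l; [lra|].
apply Rle_trans with (th ^ 5 / 120); [lra|].
assert (H3 : th ^ 3 <= (C / Q) ^ 3) by (apply pow_incr; lra).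
assert (H0 : 0 <= th ^ 3) by (apply pow_le; lra).
assert (th ^ 5 = th * (th * th ^ 3)) by ring.
assert (th * (th * th ^ 3) <= th * (1 * th ^ 3)).
{ apply Rmult_le_compat_l; [lra|]; apply Rmult_le_compat_r; lra. }
assert (th * th ^ 3 <= th * (C / Q) ^ 3) by (apply Rmult_le_compat_l; lra).
assert (0 <= th * th ^ 3) by (apply Rmult_le_pos; lra).
lra.
Qed.

Lemma sin_defect (x C Q : R) : 0 <= x <= C / Q -> C / Q <= 1 -> 1 <= Q ->
  Rabs (sin x - x) <= C ^ 3 / Q ^ 3.
Proof.
intros Hx HC HQ; destruct (sin_bounds x ltac:(lra)) as [H1 H2].
assert (H3 : x ^ 3 <= (C / Q) ^ 3) by (apply pow_incr; lra).
replace (C ^ 3 / Q ^ 3) with ((C / Q) ^ 3) by (field; lra).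
assert (H0 : 0 <= x ^ 3) by (apply pow_le; lra).
assert (x ^ 5 <= x ^ 3).
{ replace (x ^ 5) with (x ^ 3 * (x * x)) by ring; rewrite <- (Rmult_1_r (x ^ 3)) at 2.
  apply Rmult_le_compat_l; nra. }
apply Rabs_le; lra.
Qed.

Lemma uniform_bound (f : nat -> R) (k : nat) :
  exists A, 10 <= A /\ forall j, (j < k)%nat -> f j <= A.
Proof.
induction k as [|k [A [HA H]]]; [exists 10; split; [lra|lia]|].
exists (Rmax A (f k)); split; [apply Rle_trans with (1 := HA), Rmax_l|].
intros j Hj; destruct (Nat.eq_dec j k) as [->|]; [apply Rmax_r|].
apply Rle_trans with A; [apply H; lia|apply Rmax_l].
Qed.

(** Rounding down the cumulated shares, instead of each share, makes the total exactly [q]; a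
    difference of two roundings is off by at most 1. *)
Lemma integer_counts (k q : nat) (s : nat -> R) :
  (forall j, (j < k)%nat -> 0 <= s j) -> rsum s k = 1 ->
  exists N : nat -> nat, N 0%nat = 0%nat /\ N k = q /\
    forall j, (j < k)%nat -> Rabs (INR (N (S j)) - INR (N j) - INR q * s j) <= 1.
Proof.
intros Hs H1.
assert (Hpos : forall j, (j <= k)%nat -> 0 <= INR q * rsum s j).
{ intros j Hj; apply Rmult_le_pos; [apply pos_INR|].
  induction j as [|j IH]; simpl; [lra|].
  apply Rplus_le_le_0_compat; [apply IH; lia|apply Hs; lia]. }
destruct (functional_choice (fun j n => (j <= k)%nat ->
  INR n <= INR q * rsum s j < INR n + 1)) as [N HN].
{ intros j; destruct (Nat.le_gt_cases j k) as [H|H].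
  - destruct (nfloor_ex _ (Hpos j H)) as [n Hn]; now exists n.
  - exists 0%nat; lia. }
exists N; split; [|split].
- destruct (HN 0%nat ltac:(lia)) as [H _]; simpl in H; rewrite Rmult_0_r in H.
  apply (INR_le _ 0) in H; lia.
- destruct (HN k ltac:(lia)) as [H H']; rewrite H1, Rmult_1_r in H, H'.
  apply INR_le in H; rewrite <- S_INR in H'; apply INR_lt in H'; lia.
- intros j Hj; pose proof (HN j ltac:(lia)); pose proof (HN (S j) ltac:(lia)).
  simpl in *; apply Rabs_le; lra.
Qed.

Lemma continuous_rsum (f : nat -> R -> R) (k : nat) (x : R) :
  (forall j, (j < k)%nat -> continuous (f j) x) ->
  continuous (fun t => rsum (fun j => f j t) k) x.
Proof.
induction k as [|k IH]; intros H; simpl; [apply continuous_const|].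
apply (continuous_plus (V := R_NormedModule)); [apply IH; intros; apply H; lia|apply H; lia].
Qed.

Lemma bigO_of_approx (u : nat -> R) (c : R) : approx (fun q => u q * INR q ^ 2) c ->
  bigO_inv_pow 3 (fun q => u q - c / INR q ^ 2).
Proof.
intros [M [N H]]; exists M, (N + 1)%nat; intros q Hq.
assert (Hq0 : 0 < INR q) by (apply lt_0_INR; lia).
replace (u q - c / INR q ^ 2) with ((u q * INR q ^ 2 - c) / INR q ^ 2) by (field; lra).
rewrite Rabs_div by (apply pow_nonzero; lra).
rewrite (Rabs_right (INR q ^ 2)) by (apply Rle_ge, pow_le; lra).
apply Rle_div_l; [apply pow_lt; lra|].
apply Rle_trans with (1 := H q ltac:(lia)), Req_le; field; lra.
Qed.

Lemma approx_near (f : nat -> R) (l : R) (e : posreal) : approx f l ->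
  eventually (fun q => l - e < f q < l + e).
Proof.
intros [M [N H]]; destruct (INR_unbounded (Rabs M / e)) as [N' HN'].
exists (N + N' + 1)%nat; intros q Hq; pose proof (H q ltac:(lia)) as H1; rewrite pow_1 in H1.
assert (Hq0 : 0 < INR q) by (apply lt_0_INR; lia).
assert (HN'q : INR N' <= INR q) by (apply le_INR; lia).
pose proof (cond_pos e) as He.
assert (H2 : M / INR q < e).
{ apply Rlt_div_l; [easy|]; pose proof (Rle_abs M).
  assert (H3 : Rabs M / e < INR q) by lra; apply Rlt_div_l in H3; lra. }
assert (H3 : Rabs (f q - l) < e) by lra.
apply Rabs_lt_between in H3; lra.
Qed.

(** Even indices approach [a], odd ones approach [b], and eventually all terms lie between [a - e]
    and [b + e]. *)
Lemma alternating_limits (u f g : nat -> R) (a b : R) : a < b -> approx f a -> approx g b ->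
  (forall q, u q = if Nat.even q then f q else g q) ->
  LimInf_seq u = Finite a /\ LimSup_seq u = Finite b.
Proof.
intros Hab Hf Hg Hu; split.
- apply is_LimInf_seq_unique; intros e; split.
  + intros N; destruct (approx_near f a e Hf) as [N1 H1].
    exists (2 * (N + N1))%nat; split; [lia|]; rewrite Hu.
    rewrite Nat.even_mul; simpl orb; apply H1; lia.
  + destruct (approx_near f a e Hf) as [N1 H1]; destruct (approx_near g b e Hg) as [N2 H2].
    exists (N1 + N2)%nat; intros q Hq; rewrite Hu.
    pose proof (H1 q ltac:(lia)); pose proof (H2 q ltac:(lia)).
    destruct (Nat.even q); lra.
- apply is_LimSup_seq_unique; intros e; split.
  + intros N; destruct (approx_near g b e Hg) as [N1 H1].
    exists (S (2 * (N + N1)))%nat; split; [lia|]; rewrite Hu.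
    rewrite Nat.even_succ, <- Nat.negb_even, Nat.even_mul; simpl negb; cbv iota; apply H1; lia.
  + destruct (approx_near f a e Hf) as [N1 H1]; destruct (approx_near g b e Hg) as [N2 H2].
    exists (N1 + N2)%nat; intros q Hq; rewrite Hu.
    pose proof (H1 q ltac:(lia)); pose proof (H2 q ltac:(lia)).
    destruct (Nat.even q); lra.
Qed.

(** * The family of trajectories and its limit coefficient *)

Section Asymptotics.

Variables (G : arcs) (HG : circular_polygon G).
Local Notation k := (nb_arcs G).
Definition cbrt_radius (j : nat) := Rpower (radius G j) (1 / 3).
Definition arc_width (j : nat) := angle G (S j) - angle G j.

(* Impacts are distributed among the arcs proportionally to
   [arc_width j * (1 - t + t * cbrt_radius j)]: equal angles of incidence at
   [t = 0], maximal length at [t = 1]. *)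
Definition share (t : R) (j : nat) := (1 - t) + t * cbrt_radius j.

(** With S the sum of the [arc_width j * share t j], the angles are close to S / (2 q share_j), and
    arc [j] contributes - r_j arc_width_j th_j^2 / 6 to the length. *)
Definition limit_coeff (t : R) : R :=
  - (1 / 24) * rsum (fun j => arc_width j * share t j) k ^ 2 *
    rsum (fun j => cbrt_radius j ^ 3 * arc_width j / share t j ^ 2) k.

Lemma cbrt_radius_pos (j : nat) : 0 < cbrt_radius j.
Proof. apply exp_pos. Qed.

Lemma cbrt_radius_cube (j : nat) : (j < k)%nat -> cbrt_radius j ^ 3 = radius G j.
Proof.
intros Hj; unfold cbrt_radius; rewrite <- Rpower_pow by apply exp_pos.
rewrite Rpower_mult; replace (1 / 3 * INR 3) with 1 by (simpl; field).
apply Rpower_1, (cp_radius _ HG j Hj).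
Qed.

Lemma arc_width_pos (j : nat) : (j < k)%nat -> 0 < arc_width j.
Proof. intros Hj; pose proof (cp_angle _ HG j Hj); unfold arc_width; lra. Qed.

Lemma arc_width_sum : rsum arc_width k = 2 * PI.
Proof. unfold arc_width; rewrite rsum_telescope; rewrite (cp_turn _ HG); ring. Qed.

Lemma perimeter_sum : perimeter G = rsum (fun j => cbrt_radius j ^ 3 * arc_width j) k.
Proof.
rewrite (perimeter_eq G HG).
assert (H : forall m, (m <= k)%nat -> arclength_sum G m = rsum (fun j => cbrt_radius j ^ 3 * arc_width j) m).
{ induction m as [|m IH]; intros Hm; simpl arclength_sum; simpl rsum; [easy|].
  rewrite IH by lia; rewrite <- (cbrt_radius_cube m) by lia; easy. }
now apply H.
Qed.

Lemma share_pos (t : R) (j : nat) : 0 <= t <= 1 -> 0 < share t j.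
Proof. intros Ht; pose proof (cbrt_radius_pos j); unfold share; nra. Qed.

Lemma arc_bounds : exists A, 10 <= A /\ forall j, (j < k)%nat ->
  / A <= arc_width j <= A /\ / A <= cbrt_radius j <= A /\ / A <= Rabs (cbrt_radius j - cbrt_radius (S j mod k)%nat).
Proof.
pose proof (cp_nb_arcs _ HG) as Hk.
set (gap := fun j => Rabs (cbrt_radius j - cbrt_radius (S j mod k)%nat)).
assert (Hgap : forall j, (j < k)%nat -> 0 < gap j).
{ intros j Hj; apply Rabs_pos_lt; intros H.
  apply (cp_not_C2 _ HG j Hj).
  pose proof (cbrt_radius_cube j Hj) as H1; pose proof (cbrt_radius_cube _ (mod_lt k (S j) Hk)) as H2.
  rewrite <- H1, <- H2; f_equal; lra. }
destruct (uniform_bound (fun j => arc_width j + cbrt_radius j + / arc_width j + / cbrt_radius j + / gap j) k) as [A [HA H]].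
exists A; split; [easy|intros j Hj; specialize (H j Hj); cbv beta in H].
pose proof (arc_width_pos j Hj) as H1; pose proof (cbrt_radius_pos j) as H2; specialize (Hgap j Hj).
pose proof (Rinv_0_lt_compat _ H1) as H1'; pose proof (Rinv_0_lt_compat _ H2) as H2'.
pose proof (Rinv_0_lt_compat _ Hgap) as H3'.
assert (Hinv : forall x, 0 < x -> / x <= A -> / A <= x).
{ intros x Hx Hx'; rewrite <- (Rinv_inv x); apply Rinv_le_contravar; [|easy].
  now apply Rinv_0_lt_compat. }
fold (gap j); repeat split; try lra; apply Hinv; lra.
Qed.

(** For each large [q], round the shares to integer counts, solve for the angles, build the orbit,
    then pass to the limit arc by arc. *)
Lemma trajectories (t : R) : 0 <= t <= 1 -> exists g,
  eventually (fun q => one_turn_periodic G q (g q)) /\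
  approx (fun q => (traj_length G q (g q) - perimeter G) * INR q ^ 2) (limit_coeff t).
Proof.
intros Ht.
pose proof (cp_nb_arcs _ HG) as Hk.
destruct arc_bounds as [A [HA HB]].
assert (HAp : forall i, 0 < A ^ i) by (intros; apply pow_lt; lra).
destruct (INR_unbounded (300000 * A ^ 18)) as [Q0 HQ0].
set (l := fun (q : nat) j => (1 - t) + (t + 600 * A ^ 7 / INR q) * cbrt_radius j).
set (W := fun q => rsum (fun j => arc_width j * l q j) k).
assert (Hq1 : forall q, (Q0 <= q)%nat -> 1 <= INR q).
{ intros q Hq; apply le_INR in Hq.
  assert (1 <= A ^ 18) by (apply pow_R1_Rle; lra); lra. }
assert (Hlq : forall q, (Q0 <= q)%nat -> forall j, 0 < l q j).
{ intros q Hq j; specialize (Hq1 q Hq); pose proof (cbrt_radius_pos j); unfold l.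
  assert (0 < 600 * A ^ 7 / INR q) by (apply Rdiv_lt_0_compat; [pose proof (HAp 7%nat); lra|lra]).
  assert (0 < (t + 600 * A ^ 7 / INR q) * cbrt_radius j) by (apply Rmult_lt_0_compat; lra); lra. }
assert (HWp : forall q, (Q0 <= q)%nat -> 0 < W q).
{ intros q Hq; specialize (Hlq q Hq).
  apply Rlt_le_trans with (arc_width 0%nat * l q 0%nat).
  - apply Rmult_lt_0_compat; [apply arc_width_pos; lia|easy].
  - apply (rsum_ge_term (fun j => arc_width j * l q j)); [|lia].
    intros j Hj; apply Rmult_le_pos; [now apply Rlt_le, arc_width_pos|now apply Rlt_le]. }
set (cnt := fun (N : nat -> nat) j => INR (N (S j)) - INR (N j)).
(* Choice must provide the counts and angles together with the orbit, since the limits are computed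
   from them. *)
set (P := fun (q : nat) (x : (nat -> R * R) * (nat -> nat) * (nat -> R) * (nat -> R)) =>
  let '(g, N, th, be) := x in
  one_turn_periodic G q g /\
  traj_length G q g = rsum (fun j =>
    radius G j * (2 * cnt N j * sin (th j) + sin (be j) - sin (be (S j)))) k /\
  (forall j, (j < k)%nat -> 0 < th j <= 48 * A ^ 4 / INR q) /\
  48 * A ^ 4 / INR q <= 1 /\
  (forall j, (j <= k)%nat -> 0 <= be j <= 48 * A ^ 4 / INR q) /\
  (forall j, (j < k)%nat -> 2 * cnt N j * th j = arc_width j + be (S j) - be j) /\
  (forall j, (j < k)%nat -> 1 <= cnt N j) /\
  (forall j, (j < k)%nat -> Rabs (W q / (2 * INR q * th j) - l q j) <= 300 * A ^ 6 / INR q)).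
destruct (functional_choice (fun q x => (Q0 <= q)%nat -> P q x)) as [F HF].
{ intros q; destruct (Nat.le_gt_cases Q0 q) as [Hq|Hq].
  2:{ exists (fun _ => (0, 0), fun _ => 0%nat, fun _ => 0, fun _ => 0); lia. }
  assert (HQ : 300000 * A ^ 18 <= INR q) by (apply le_INR in Hq; lra).
  specialize (Hlq q Hq); specialize (HWp q Hq).
  destruct (integer_counts k q (fun j => arc_width j * l q j / W q)) as (N & N0 & Nk & HN).
  { intros j Hj; apply Rmult_le_pos; [apply Rmult_le_pos|];
      [now apply Rlt_le, arc_width_pos|now apply Rlt_le|now apply Rlt_le, Rinv_0_lt_compat]. }
  { rewrite (rsum_ext _ (fun j => / W q * (arc_width j * l q j))) by (intros; field; lra).
    rewrite rsum_scal; fold (W q); field; lra. }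
  destruct (profile_exists k cbrt_radius arc_width (cnt N) A (INR q) t) as
    (th & be & T1 & T2 & T3 & T4 & T5 & T6 & T7 & T8 & T9); auto; try (intros j Hj; now apply HB).
  { apply arc_width_sum. }
  { intros j Hj; specialize (HN j Hj); fold (l q); unfold cnt.
    replace (INR q * arc_width j * _ / _) with (INR q * (arc_width j * l q j / W q)); [easy|].
    fold (l q j); unfold W, Rdiv; rewrite <- !Rmult_assoc; easy. }
  assert (Hbe : forall j, (j <= k)%nat -> 0 <= be j <= 48 * A ^ 4 / INR q).
  { intros j Hj; split; [auto|].
    destruct j as [|j].
    - rewrite <- T5; replace k with (S (k - 1)) at 1 by lia.
      apply Rle_trans with (1 := T4 (k - 1)%nat ltac:(lia)), T1; lia.
    - apply Rle_trans with (1 := T4 j Hj), T1; lia. }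
  assert (Hn1 : forall j, (j < k)%nat -> (N j < N (S j))%nat).
  { intros j Hj; specialize (T8 j Hj); unfold cnt in T8; apply INR_lt; lra. }
  destruct (exists_trajectory G HG N th be) as (g & G1 & G2); auto.
  - intros j Hj; specialize (T1 j Hj); lra.
  - intros j Hj; rewrite <- !cbrt_radius_cube by (auto; now apply mod_lt).
    now apply T7.
  - rewrite Nk in G1, G2; exists (g, N, th, be); intros _; unfold P.
    split; [exact G1|split; [exact G2|]]; repeat split; auto; try (now apply T1); try (now apply Hbe). }
set (g := fun q => fst (fst (fst (F q)))); set (N := fun q => snd (fst (fst (F q)))).
set (th := fun q => snd (fst (F q))); set (be := fun q => snd (F q)).
assert (HP : forall q, (Q0 <= q)%nat -> P q (g q, N q, th q, be q)).
{ intros q Hq; specialize (HF q Hq); unfold g, N, th, be.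
  now destruct (F q) as [[[? ?] ?] ?]. }
clear HF; exists g; split.
{ exists Q0; intros q Hq; now destruct (HP q Hq) as [H _]. }
set (C := 48 * A ^ 4).
assert (HC : 0 < C) by (unfold C; pose proof (HAp 4%nat); lra).
assert (Hl : forall j, approx (fun q => l q j) (share t j)).
{ intros j; exists (600 * A ^ 7 * cbrt_radius j), 1%nat; intros q Hq.
  assert (0 < INR q) by (apply lt_0_INR; lia).
  unfold l, share.
  replace (_ - _) with (600 * A ^ 7 * cbrt_radius j / INR q ^ 1) by (field; lra).
  rewrite Rabs_right; [lra|].
  apply Rle_ge, Rmult_le_pos; [|rewrite pow_1; now apply Rlt_le, Rinv_0_lt_compat].
  pose proof (HAp 7%nat); pose proof (cbrt_radius_pos j); nra. }
assert (HW : approx W (rsum (fun j => arc_width j * share t j) k)).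
{ apply (approx_rsum (fun q j => arc_width j * l q j)); intros j Hj.
  apply (approx_mult (fun _ => arc_width j) (fun q => l q j)); [apply approx_const|apply Hl]. }
set (mu := fun q j => W q / (2 * INR q * th q j)).
assert (Hmu : forall j, (j < k)%nat -> approx (fun q => mu q j) (share t j)).
{ intros j Hj; apply approx_ext with (fun q => l q j + (mu q j - l q j)).
  - exists 0%nat; intros; ring.
  - rewrite <- (Rplus_0_r (share t j)); apply approx_plus; [apply Hl|].
    exists (300 * A ^ 6), Q0; intros q Hq; rewrite Rminus_0_r, pow_1.
    destruct (HP q Hq) as (_ & _ & _ & _ & _ & _ & _ & H); now apply H. }
set (D := fun q j => 2 * cnt (N q) j * th q j).
assert (HD : forall j, (j < k)%nat -> approx (fun q => D q j) (arc_width j)).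
{ intros j Hj; exists C, Q0; intros q Hq; rewrite pow_1.
  destruct (HP q Hq) as (_ & _ & _ & _ & H1 & H2 & _).
  unfold D; rewrite H2 by easy.
  fold C in H1; pose proof (H1 j ltac:(lia)); pose proof (H1 (S j) Hj).
  apply Rabs_le; lra. }
assert (Hbs : forall j, (j <= k)%nat ->
  approx (fun q => INR q ^ 2 * (sin (be q j) - be q j)) 0).
{ intros j Hj; apply approx_scaled with (C ^ 3); exists Q0; intros q Hq.
  destruct (HP q Hq) as (_ & _ & _ & H1 & H2 & _); fold C in H1, H2.
  apply sin_defect; auto. }
assert (Hterm : forall j, (j < k)%nat -> approx (fun q => INR q ^ 2 *
    (radius G j * (2 * cnt (N q) j * sin (th q j) + sin (be q j) - sin (be q (S j)))
     - cbrt_radius j ^ 3 * arc_width j))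
  (cbrt_radius j ^ 3 * ((- (1 / 24)) * (arc_width j * (rsum (fun j => arc_width j * share t j) k ^ 2 * / (share t j) ^ 2))))).
{ intros j Hj.
  assert (Hsq : forall f a, approx f a -> approx (fun q => f q ^ 2) (a ^ 2)).
  { intros f a Hf; simpl; apply approx_mult; [easy|].
    apply approx_mult; [easy|apply approx_const]. }
  apply approx_ext with (fun q => cbrt_radius j ^ 3 * ((- (1 / 24)) * (D q j * (W q ^ 2 * / mu q j ^ 2))
    + INR q ^ 2 * (2 * cnt (N q) j * (sin (th q j) - th q j) + D q j * th q j ^ 2 / 6)
    + (INR q ^ 2 * (sin (be q j) - be q j)
       + (- 1) * (INR q ^ 2 * (sin (be q (S j)) - be q (S j)))))).
  - exists Q0; intros q Hq; specialize (HWp q Hq); specialize (Hq1 q Hq).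
    destruct (HP q Hq) as (_ & _ & H1 & _ & _ & H2 & _).
    specialize (H1 j Hj); specialize (H2 j Hj).
    rewrite <- cbrt_radius_cube by easy.
    replace (arc_width j) with (2 * cnt (N q) j * th q j - be q (S j) + be q j) by lra.
    unfold mu, D; field; lra.
  - apply (approx_mult (fun _ => cbrt_radius j ^ 3)); [apply approx_const|].
    match goal with |- approx _ ?x => replace x with (x + 0 + (0 + (- 1) * 0)) by ring end.
    apply approx_plus; [apply approx_plus|].
    + apply (approx_mult (fun _ => - (1 / 24))); [apply approx_const|].
      apply (approx_mult (fun q => D q j)); [now apply HD|].
      apply (approx_mult (fun q => W q ^ 2)); [now apply Hsq|].
      apply approx_inv; [apply pow_lt, share_pos; easy|].
      apply (Hsq (fun q => mu q j)); now apply Hmu.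
    + apply approx_scaled with (2 * A * C ^ 3); exists Q0; intros q Hq.
      destruct (HP q Hq) as (_ & _ & H1 & H2 & H3 & H4 & H5 & _); fold C in H1, H2, H3.
      specialize (H1 j Hj); specialize (H4 j Hj); specialize (H5 j Hj).
      apply Rle_trans with (2 * cnt (N q) j * th q j * C ^ 3 / INR q ^ 3).
      * apply sin_defect_arc; try lra; now apply Hq1.
      * apply Rmult_le_compat_r; [apply Rlt_le, Rinv_0_lt_compat, pow_lt; pose proof (Hq1 q Hq); lra|].
        apply Rmult_le_compat_r; [apply pow_le; lra|].
        rewrite H4; pose proof (H3 j ltac:(lia)); pose proof (H3 (S j) Hj).
        destruct (HB j Hj) as [[_ ?] _]; lra.
    + apply (approx_plus (fun q => INR q ^ 2 * (sin (be q j) - be q j))); [apply Hbs; lia|].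
      apply (approx_mult (fun _ => -1)); [apply approx_const|now apply Hbs]. }
apply approx_rsum in Hterm.
revert Hterm; match goal with |- approx _ ?x -> _ => replace x with (limit_coeff t) end.
- apply approx_ext; exists Q0; intros q Hq.
  destruct (HP q Hq) as (_ & -> & _).
  rewrite rsum_scal, perimeter_sum, Rmult_comm; f_equal; apply rsum_minus.
- unfold limit_coeff; set (W0 := rsum _ k); rewrite <- rsum_scal.
  apply rsum_ext; intros j Hj; unfold Rdiv; ring.
Qed.

(** * Extreme values and range of the limit coefficient *)

Lemma limit_coeff_0 : limit_coeff 0 = - (PI ^ 2 * perimeter G / 6).
Proof.
unfold limit_coeff, share; rewrite perimeter_sum.
rewrite (rsum_ext _ arc_width) by (intros; ring); rewrite arc_width_sum.
rewrite (rsum_ext _ (fun j => cbrt_radius j ^ 3 * arc_width j)) by (intros; field; lra).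
field.
Qed.

Lemma limit_coeff_1 : limit_coeff 1 = - (1 / 24) * rsum (fun j => cbrt_radius j * arc_width j) k ^ 3.
Proof.
unfold limit_coeff, share.
rewrite (rsum_ext _ (fun j => cbrt_radius j * arc_width j)) by (intros; ring).
rewrite (rsum_ext (fun j => _ / _) (fun j => cbrt_radius j * arc_width j)); [ring|].
intros j _; pose proof (cbrt_radius_pos j); field; lra.
Qed.

Lemma limit_coeff_1_neg : limit_coeff 1 < 0.
Proof.
pose proof (cp_nb_arcs _ HG) as Hk.
rewrite limit_coeff_1.
assert (0 < rsum (fun j => cbrt_radius j * arc_width j) k ^ 3); [|lra].
apply pow_lt, Rlt_le_trans with (cbrt_radius 0%nat * arc_width 0%nat).
- apply Rmult_lt_0_compat; [apply cbrt_radius_pos|apply arc_width_pos; lia].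
- apply (rsum_ge_term (fun j => cbrt_radius j * arc_width j)); [|lia].
  intros j Hj; apply Rmult_le_pos; apply Rlt_le; [apply cbrt_radius_pos|now apply arc_width_pos].
Qed.

(* Jensen's inequality for the cube and the weights [arc_width], strict because two
   consecutive radii differ. *)
Lemma limit_coeff_lt : limit_coeff 0 < limit_coeff 1.
Proof.
pose proof (cp_nb_arcs _ HG) as Hk.
rewrite limit_coeff_0, limit_coeff_1, perimeter_sum.
pose proof PI_RGT_0 as Hpi.
set (P := rsum (fun j => cbrt_radius j * arc_width j) k).
set (R3 := rsum (fun j => cbrt_radius j ^ 3 * arc_width j) k).
(* The mean of the cube roots for the weights [arc_width j], of total 2 pi. *)
set (m := P / (2 * PI)).
assert (Hm : 0 <= m).
{ apply Rdiv_le_0_compat; [|lra]; unfold P.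
  replace 0 with (rsum (fun _ => 0 * 0) k) by (rewrite rsum_scal; ring).
  apply rsum_le; intros j Hj; apply Rmult_le_compat; try lra;
    apply Rlt_le; [apply cbrt_radius_pos|now apply arc_width_pos]. }
assert (Hex : exists i, (i < k)%nat /\ cbrt_radius i <> m).
{ destruct (Req_dec (cbrt_radius 0%nat) m) as [e|e]; [|exists 0%nat; split; [lia|easy]].
  exists 1%nat; split; [lia|]; intros e'.
  apply (cp_not_C2 _ HG 0%nat ltac:(lia)); rewrite Nat.mod_small by lia.
  rewrite <- (cbrt_radius_cube 0%nat), <- (cbrt_radius_cube 1%nat) by lia; f_equal; lra. }
destruct Hex as [i [Hi Hne]].
(* x^3 minus its tangent line at [m] equals (x - m)^2 (x + 2 m), and the linear part of that line
   averages out. *)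
assert (H : 0 < rsum (fun j => arc_width j * ((cbrt_radius j - m) ^ 2 * (cbrt_radius j + 2 * m))) k).
{ apply Rlt_le_trans with (arc_width i * ((cbrt_radius i - m) ^ 2 * (cbrt_radius i + 2 * m))).
  - pose proof (cbrt_radius_pos i); apply Rmult_lt_0_compat; [now apply arc_width_pos|].
    apply Rmult_lt_0_compat; [apply pow2_gt_0; lra|lra].
  - apply (rsum_ge_term (fun j => arc_width j * ((cbrt_radius j - m) ^ 2 * (cbrt_radius j + 2 * m)))); [|easy].
    intros j Hj; pose proof (cbrt_radius_pos j); apply Rmult_le_pos; [now apply Rlt_le, arc_width_pos|].
    apply Rmult_le_pos; [apply pow2_ge_0|lra]. }
rewrite (rsum_ext _ (fun j => cbrt_radius j ^ 3 * arc_width j -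
   (3 * m ^ 2 * (cbrt_radius j * arc_width j) - 2 * m ^ 3 * arc_width j))) in H by (intros; ring).
rewrite !rsum_minus, !rsum_scal, arc_width_sum in H; fold P R3 in H.
replace P with (m * (2 * PI)) in * by (unfold m; field; lra).
assert (H' : 0 < PI ^ 2 * (R3 - 2 * PI * m ^ 3)).
{ apply Rmult_lt_0_compat; [apply pow_lt; lra|]; nra. }
nra.
Qed.

Lemma limit_coeff_continuous (t : R) : 0 <= t <= 1 -> continuous limit_coeff t.
Proof.
intros Ht; unfold limit_coeff.
apply (continuous_mult (K := R_AbsRing)).
- apply (continuous_mult (K := R_AbsRing)); [apply continuous_const|].
  apply (continuous_comp _ (fun x => x ^ 2)).
  + apply (continuous_rsum (fun j t => arc_width j * share t j)); intros j _.
    apply (ex_derive_continuous (V := R_NormedModule)); unfold share; auto_derive; easy.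
  + apply (ex_derive_continuous (V := R_NormedModule)); auto_derive; easy.
- apply (continuous_rsum (fun j t => cbrt_radius j ^ 3 * arc_width j / share t j ^ 2)); intros j _.
  apply (ex_derive_continuous (V := R_NormedModule)).
  pose proof (share_pos t j Ht) as H; unfold share in *; auto_derive; nra.
Qed.

Lemma limit_coeff_onto (c : R) : limit_coeff 0 <= c <= limit_coeff 1 ->
  exists t, 0 <= t <= 1 /\ limit_coeff t = c.
Proof.
intros Hc.
destruct (Req_dec c (limit_coeff 0)) as [->|n0]; [exists 0; split; [lra|easy]|].
destruct (Req_dec c (limit_coeff 1)) as [->|n1]; [exists 1; split; [lra|easy]|].
destruct (IVT_interv (fun t => limit_coeff t - c) 0 1) as [t [Ht Hz]]; try lra.
- intros t Ht; apply continuity_pt_filterlim.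
  apply (continuous_minus (V := R_NormedModule)); [now apply limit_coeff_continuous|].
  apply continuous_const.
- exists t; split; [easy|lra].
Qed.

(** On an arc of radius r, kappa^(2/3) ds = r^(-2/3) r dphi = r^(1/3) dphi. *)
Lemma curvature_integral :
  RInt (fun s => Rpower (curvature G s) (2 / 3)) 0 (perimeter G) =
  rsum (fun j => cbrt_radius j * arc_width j) k.
Proof.
apply is_RInt_unique; rewrite (perimeter_eq G HG).
assert (H : forall m, (m <= k)%nat ->
  is_RInt (fun s => Rpower (curvature G s) (2 / 3)) 0 (arclength_sum G m)
    (rsum (fun j => cbrt_radius j * arc_width j) m)); [|now apply H].
induction m as [|m IH]; intros Hm; [apply (is_RInt_point (V := R_NormedModule))|].
apply (is_RInt_Chasles (V := R_NormedModule)) with (arclength_sum G m); [apply IH; lia|].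
pose proof (cp_radius _ HG m Hm) as Hr; pose proof (arc_width_pos m Hm) as Hd.
assert (Hstep : forall i, (i < k)%nat -> arclength_sum G i <= arclength_sum G (S i)).
{ intros i Hi; simpl; pose proof (cp_radius _ HG i Hi); pose proof (arc_width_pos i Hi) as H0.
  unfold arc_width in H0; nra. }
apply is_RInt_ext with (fun _ => Rpower (/ radius G m) (2 / 3)).
- intros s; rewrite Rmin_left, Rmax_right by now apply Hstep.
  intros Hs; unfold curvature; do 3 f_equal; symmetry; apply cell_eq; [|lia| |].
  + intros i Hi; rewrite !arclength_angle by (auto; lia); apply Hstep; lia.
  + rewrite arclength_angle by (auto; lia); lra.
  + intros _; rewrite arclength_angle by (auto; lia); lra.
- replace (cbrt_radius m * arc_width m) with
    (scal (arclength_sum G (S m) - arclength_sum G m) (Rpower (/ radius G m) (2 / 3))).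
  { apply (is_RInt_const (V := R_NormedModule)). }
  unfold scal; simpl; unfold mult; simpl; fold (arc_width m).
  assert (E : radius G m * Rpower (/ radius G m) (2 / 3) = cbrt_radius m).
  { unfold cbrt_radius, Rpower; rewrite ln_Rinv by easy; rewrite <- (exp_ln (radius G m)) at 1 by easy.
    rewrite <- exp_plus; f_equal; field. }
  rewrite <- E; ring.
Qed.

Lemma length_spectrum (c : R) : limit_coeff 0 <= c <= limit_coeff 1 -> exists g,
  eventually (fun q => one_turn_periodic G q (g q)) /\
  approx (fun q => (traj_length G q (g q) - perimeter G) * INR q ^ 2) c.
Proof. intros Hc; destruct (limit_coeff_onto c Hc) as [t [Ht <-]]; now apply trajectories. Qed.

End Asymptotics.

Theorem theorem5 : forall G : arcs, circular_polygon G ->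
  exists cm cp : R,
    cm < cp /\ cp < 0 /\
    (forall c : R, cm <= c <= cp ->
       exists g : nat -> nat -> R * R,
         eventually (fun q : nat => one_turn_periodic G q (g q)) /\
         bigO_inv_pow 3 (fun q : nat =>
           traj_length G q (g q) - (perimeter G + c / INR q ^ 2))) /\
    (exists h : nat -> nat -> R * R,
       eventually (fun q : nat => one_turn_periodic G q (h q)) /\
       let u := fun q : nat =>
         (traj_length G q (h q) - perimeter G) * INR q ^ 2 in
       LimInf_seq u = Finite cm /\
       Rbar_lt (LimInf_seq u) (LimSup_seq u) /\
       LimSup_seq u = Finite cp) /\
    cm <= - (PI ^ 2 * perimeter G / 6) /\
    cp = - (1 / 24) *
      (RInt (fun s : R => Rpower (curvature G s) (2 / 3)) 0 (perimeter G)) ^ 3.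
Proof.
intros G HG; pose proof (limit_coeff_lt G HG) as Hlt.
(* The lower constant is the coefficient for equal angles of incidence, so its stated bound holds
   with equality. *)
exists (limit_coeff G 0), (limit_coeff G 1).
split; [easy|split; [now apply limit_coeff_1_neg|split; [|split; [|split]]]].
- intros c Hc; destruct (length_spectrum G HG c Hc) as (g & H1 & H2); exists g; split; [easy|].
  apply bigO_of_approx in H2; destruct H2 as [M [N H]]; exists M, N; intros q Hq.
  replace (_ - _) with (traj_length G q (g q) - perimeter G - c / INR q ^ 2) by ring; auto.
- destruct (length_spectrum G HG (limit_coeff G 0) ltac:(lra)) as (g & [N1 H1] & H2).
  destruct (length_spectrum G HG (limit_coeff G 1) ltac:(lra)) as (g' & [N1' H1'] & H2').
  (* Alternating between the families of the two extreme coefficients realises both limits. *)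
  exists (fun q => if Nat.even q then g q else g' q); split.
  + exists (N1 + N1')%nat; intros q Hq.
    destruct (Nat.even q); [apply H1|apply H1']; lia.
  + intros u; destruct (alternating_limits u _ _ _ _ Hlt H2 H2') as [-> ->].
    * intros q; unfold u; now destruct (Nat.even q).
    * repeat split; easy.
- rewrite limit_coeff_0 by easy; lra.
- now rewrite limit_coeff_1, curvature_integral by easy.
Qed.
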